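(* For any balanced rooted tree $(T, R)$ with at least one edge, there exists a positive integer $p$ such that the family $\mathcal{T}^p$ (the $p$th power of $(T,R)$) satisfies \[\mathrm{ex}(n, \mathcal{T}^p) = \Omega(n^{2 - 1/\rho_T}),\] i.e. there are constants $c > 0$ and $n_0$ such that $\mathrm{ex}(n, \mathcal{T}^p) \ge c\, n^{2 - 1/\rho_T}$ for all integers $n \ge n_0$.
   Context: Graphs are finite, simple and undirected. Given a family of graphs $\mathcal{H}$, a graph is $\mathcal{H}$-free if it contains no graph from $\mathcal{H}$ as a (not necessarily induced) subgraph, and $\mathrm{ex}(n, \mathcal{H})$ is the largest number of edges in an $\mathcal{H}$-free graph on $n$ vertices. A rooted tree $(T, R)$ consists of a tree $T$ together with an independent set $R \subset V(T)$, whose elements are called the roots; the vertices in $V(T)\setminus R$ are called unrooted. The $p$th power $\mathcal{T}^p = \mathcal{T}^p_R$ of $(T, R)$ is the family of graphs consisting of all possible unions of $p$ distinct labelled copies of $T$, each of which agree on the set of roots $R$. That is, a graph $H$ belongs to $\mathcal{T}^p$ if there are $p$ pairwise distinct injective maps $\varphi_1, \dots, \varphi_p$ from $V(T)$ to $V(H)$, all having the same restriction to $R$, such that $V(H) = \bigcup_i \varphi_i(V(T))$ and $E(H) = \bigcup_i \{\varphi_i(x)\varphi_i(y) : xy \in E(T)\}$. The unrooted vertices of the different copies may overlap in any way. The density of $(T,R)$ is $\rho_T = \frac{e(T)}{v(T) - |R|}$, where $e(T)$ and $v(T)$ are the numbers of edges and vertices of $T$. For a nonempty subset $S \subseteq V(T)\setminus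 R$, the density of $S$ is $\rho_S = e(S)/|S|$, where $e(S)$ is the number of edges of $T$ with at least one endpoint in $S$. The rooted tree $(T,R)$ is balanced if $\rho_S \ge \rho_T$ for every nonempty subset $S$ of $V(T)\setminus R$. *)

(* Defs.v *)
From HB Require Import structures.
From mathcomp Require Import all_boot all_order all_algebra.
From mathcomp Require Import boolp reals exp.

Set Implicit Arguments.
Unset Strict Implicit.
Unset Printing Implicit Defensive.

Import Order.TTheory GRing.Theory Num.Theory.
Local Open Scope ring_scope.

(* A finite simple undirected graph on V is a set of two-element subsets of V. *)
Record sgraph (V : finType) := SGraph {
  edges : {set {set V}};
  edges_card2 : [forall e in edges, #|e| == 2]
}.

HB.instance Definition _ (V : finType) := [isSub for @edges V].
HB.instance Definition _ (V : finType) := [Finite of sgraph V by <:].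

Definition adj (V : finType) (G : sgraph V) : rel V :=
  fun x y => [set x; y] \in edges G.

(* A copy of H in G, not necessarily induced. *)
Definition contains (V W : finType) (G : sgraph V) (H : sgraph W) : Prop :=
  exists2 f : W -> V, injective f
    & forall e, e \in edges H -> f @: e \in edges G.

Definition graph_family := forall W : finType, sgraph W -> Prop.

Definition family_free (F : graph_family) (V : finType) (G : sgraph V) : Prop :=
  forall (W : finType) (H : sgraph W), F W H -> ~ contains G H.

Definition extremal_number (n : nat) (F : graph_family) : nat :=
  \max_(G : sgraph 'I_n | `[< family_free F G >]) #|edges G|.

Definition connected (V : finType) (G : sgraph V) : Prop :=
  (0 < #|V|)%N /\ forall x y : V, connect (adj G) x y.

(* The closed walks x, y, x are cycles in the sense of [cycle], whence the
   bound 2. *)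
Definition acyclic (V : finType) (G : sgraph V) : Prop :=
  forall s : seq V, uniq s -> cycle (adj G) s -> (size s <= 2)%N.

Definition is_tree (V : finType) (G : sgraph V) : Prop :=
  connected G /\ acyclic G.

Definition independent (V : finType) (G : sgraph V) (A : {set V}) : Prop :=
  {in A &, forall x y, ~~ adj G x y}.

Definition rooted_tree (V : finType) (T : sgraph V) (roots : {set V}) : Prop :=
  is_tree T /\ independent T roots.

Definition density (V : finType) (T : sgraph V) (roots : {set V}) : rat :=
  #|edges T|%:R / (#|V| - #|roots|)%:R.

Definition set_density (V : finType) (T : sgraph V) (S : {set V}) : rat :=
  #|[set e in edges T | e :&: S != set0]|%:R / #|S|%:R.

Definition balanced (V : finType) (T : sgraph V) (roots : {set V}) : Prop :=
  forall S : {set V}, S != set0 -> S \subset ~: roots ->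
    density T roots <= set_density T S.

(* The maps are required to be distinct, not their images. *)
Definition tree_power (V : finType) (T : sgraph V) (roots : {set V}) (p : nat) :
    graph_family :=
  fun W H => exists phi : 'I_p -> {ffun V -> W},
    [/\ injective phi,
        forall i, injective (phi i),
        forall i j x, x \in roots -> phi i x = phi j x,
        \bigcup_i (phi i @: [set: V]) = [set: W]
      & \bigcup_i [set phi i @: e | e : {set V} in edges T] = edges H].

(* Main.v *)
(** Random algebraic construction, with the Lang-Weil bound replaced by quantifier
elimination. Let m be the number of unrooted vertices, b = e(T), and suppose m <= b
(otherwise there is no root, T has b + 1 vertices, and a matching or a single edge
works). Over an algebraically closed field K of characteristic p, join x and y in K^b
when the first m coordinates of y are given by m polynomials in x and the other
coordinates of y. Over a subfield with q elements this graph has 2 q^b vertices and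
q^(2b - m) edges, so it suffices to choose coefficients in that subfield for which
boundedly many copies of T extend any placement of the roots.

By quantifier elimination, the values of a fixed coordinate of an unrooted vertex, over
all copies with given roots, form a finite set of bounded size or a set with a bounded
complement, uniformly in the coefficients and the roots. In the second case one picks
successive copies in each of which that coordinate takes a new value from a fixed finite
set A. By balancedness, a copy bringing a set S of new vertices brings e(S) new edges,
with m e(S) >= b |S| equations, but only b |S| - 1 new coordinates outside A. After
enough copies there are more equations than coordinates, so the coefficients are rational
functions of fewer parameters than there are coefficients, hence satisfy a nontrivial
algebraic relation. This fails for the coefficients t^(N^i), N large, unless t is a root of a
fixed nonzero polynomial, and large finite subfields contain a t that is not. *)

Require Import Defs.
From HB Require Import structures.
From mathcomp Require Import all_boot all_order all_algebra all_field.
From mathcomp Require Import boolp reals exp zify.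

Set Implicit Arguments.
Unset Strict Implicit.
Unset Printing Implicit Defensive.

Import Order.TTheory GRing.Theory Num.Theory.
Local Open Scope ring_scope.

(** * Definable sets over an algebraically closed field *)

Section Definable.
Variable K : closedFieldType.

(** A finite or cofinite subset of [K] with fewer than [C] exceptions, witnessed by a polynomial
    vanishing at all of them. *)
Definition nearly_constant (C : nat) (P : K -> Prop) : Prop :=
  exists (h : {poly K}) (v : bool),
    [/\ h != 0, (size h <= C)%N & forall t, ~~ root h t -> P t <-> v].

(** Without inverses, a term is a polynomial in variable [i] whose coefficients involve the other
    variables. Its size is bounded by the syntax of the term alone, hence uniformly in [e]. *)
Lemma rterm_poly (t : GRing.term K) (i : nat) : GRing.rterm t ->
  exists C : nat, forall e : seq K, exists2 h : {poly K}, (size h <= C)%N &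
    forall x, GRing.eval (set_nth 0 e i x) t = h.[x].
Proof.
elim: t => //=.
- move=> j _; case: (eqVneq j i) => [->|ji].
    exists 2 => e; exists 'X => [|x]; first by rewrite size_polyX.
    by rewrite nth_set_nth /= eqxx hornerX.
  exists 1 => e; exists (e`_j)%:P => [|x]; first by rewrite size_polyC leq_b1.
  by rewrite nth_set_nth /= (negPf ji) hornerC.
- move=> a _; exists 1 => e; exists a%:P => [|x]; first by rewrite size_polyC leq_b1.
  by rewrite hornerC.
- move=> n _; exists 1 => e; exists n%:R%:P => [|x]; first by rewrite size_polyC leq_b1.
  by rewrite hornerC.
- move=> t1 IH1 t2 IH2 /andP[/IH1[C1 H1] /IH2[C2 H2]].
  exists (maxn C1 C2) => e; have [h1 s1 E1] := H1 e; have [h2 s2 E2] := H2 e.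
  exists (h1 + h2) => [|x]; last by rewrite E1 E2 hornerD.
  apply: leq_trans (size_polyD _ _) _.
  by rewrite geq_max !leq_max s1 s2 orbT.
- move=> t1 IH1 /IH1[C1 H1]; exists C1 => e; have [h1 s1 E1] := H1 e.
  by exists (- h1) => [|x]; rewrite ?size_polyN // E1 hornerN.
- move=> t1 IH1 n /IH1[C1 H1]; exists C1 => e; have [h1 s1 E1] := H1 e.
  exists (h1 *+ n) => [|x]; last by rewrite E1 hornerMn.
  by rewrite -scaler_nat; apply: leq_trans (size_scale_leq _ _) _.
- move=> t1 IH1 t2 IH2 /andP[/IH1[C1 H1] /IH2[C2 H2]].
  exists (C1 + C2)%N => e; have [h1 s1 E1] := H1 e; have [h2 s2 E2] := H2 e.
  exists (h1 * h2) => [|x]; last by rewrite E1 E2 hornerM.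
  apply: leq_trans (size_polyMleq _ _) _.
  by apply: leq_trans (leq_pred _) _; apply: leq_add.
- move=> t1 IH1 n /IH1[C1 H1]; exists (C1 * n).+1 => e; have [h1 s1 E1] := H1 e.
  exists (h1 ^+ n) => [|x]; last by rewrite E1 horner_exp.
  apply: leq_trans (size_poly_exp_leq _ _) _; rewrite ltnS leq_mul2r.
  by rewrite (leq_trans (leq_pred _) s1) orbT.
Qed.

Lemma nearly_constant_op (op : bool -> bool -> bool) (C1 C2 : nat)
    (P1 P2 : K -> bool) :
  nearly_constant C1 P1 -> nearly_constant C2 P2 ->
  nearly_constant (C1 + C2) (fun t => op (P1 t) (P2 t)).
Proof.
move=> [h1 [v1 [n1 s1 E1]]] [h2 [v2 [n2 s2 E2]]].
exists (h1 * h2), (op v1 v2); split; first by rewrite mulf_neq0.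
  apply: leq_trans (size_polyMleq _ _) _.
  by apply: leq_trans (leq_pred _) _; apply: leq_add.
move=> t; rewrite rootM negb_or => /andP[/E1 F1 /E2 F2].
have -> : P1 t = v1 by apply/idP/idP; case: F1.
by have -> : P2 t = v2 by apply/idP/idP; case: F2.
Qed.

(** An equation between two polynomials in [t] either holds identically or forces [t] to be a root
    of their difference; Boolean connectives multiply the exceptional polynomials. *)
Lemma qf_nearly_constant (f : GRing.formula K) (i : nat) :
  GRing.qf_form f && GRing.rformula f ->
  exists C : nat, forall e : seq K,
    nearly_constant C (fun t => GRing.qf_eval (set_nth 0 e i t) f).
Proof.
elim: f => //=.
- move=> v _; exists 1 => e; exists 1, v.
  by split; rewrite ?oner_eq0 ?size_poly1.
- move=> t1 t2 /andP[/(rterm_poly i)[C1 H1] /(rterm_poly i)[C2 H2]].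
  exists (maxn 1 (maxn C1 C2)) => e.
  have [h1 s1 E1] := H1 e; have [h2 s2 E2] := H2 e.
  have [E12|N12] := eqVneq h1 h2.
    exists 1, true; split; rewrite ?oner_eq0 ?size_poly1 ?leq_maxl // => t _.
    by rewrite E1 E2 E12 eqxx.
  exists (h1 - h2), false; split; first by rewrite subr_eq0.
    rewrite (leq_trans (size_polyD _ _)) // size_polyN.
    by rewrite geq_max !leq_max s1 s2 !orbT.
  by move=> t; rewrite /root hornerD hornerN subr_eq0 E1 E2 => /negPf ->.
- move=> f1 IH1 f2 IH2 /andP[/andP[q1 q2] /andP[r1 r2]].
  have [|C1 H1] := IH1; first by rewrite q1 r1.
  have [|C2 H2] := IH2; first by rewrite q2 r2.
  by exists (C1 + C2)%N => e; apply: nearly_constant_op (H1 e) (H2 e).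
- move=> f1 IH1 f2 IH2 /andP[/andP[q1 q2] /andP[r1 r2]].
  have [|C1 H1] := IH1; first by rewrite q1 r1.
  have [|C2 H2] := IH2; first by rewrite q2 r2.
  by exists (C1 + C2)%N => e; apply: nearly_constant_op (H1 e) (H2 e).
- move=> f1 IH1 f2 IH2 /andP[/andP[q1 q2] /andP[r1 r2]].
  have [|C1 H1] := IH1; first by rewrite q1 r1.
  have [|C2 H2] := IH2; first by rewrite q2 r2.
  by exists (C1 + C2)%N => e; apply: nearly_constant_op (H1 e) (H2 e).
- move=> f1 IH1 /IH1[C1 H1]; exists C1 => e; have [h1 [v1 [n1 s1 E1]]] := H1 e.
  exists h1, (~~ v1); split=> // t /E1 F1.
  by split=> /negP H; apply/negP => /F1.
Qed.

(** Strong minimality of algebraically closed fields, uniformly in the parameters: inverses and then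
    quantifiers are eliminated. *)
Lemma holds_nearly_constant (f : GRing.formula K) (i : nat) :
  exists C : nat, forall e : seq K,
    nearly_constant C (fun t => GRing.holds (set_nth 0 e i t) f).
Proof.
have Kc : GRing.closed_field_axiom K by exact: solve_monicpoly.
pose g := GRing.quantifier_elim (@ClosedFieldQE.ex_elim K) (GRing.to_rform f).
have rf := GRing.to_rform_rformula f.
have wf : GRing.qf_form g && GRing.rformula g.
  exact: GRing.quantifier_elim_wf (@ClosedFieldQE.wf_ex_elim K) _ rf.
have QE e := GRing.quantifier_elim_rformP (@ClosedFieldQE.wf_ex_elim K)
  (ClosedFieldQE.holds_ex_elim Kc) e rf.
have [C HC] := qf_nearly_constant i wf.
exists C => e; have [h [v [h0 sh E]]] := HC e; exists h, v; split=> // t /E Et.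
rewrite -Et; split=> [/GRing.to_rformP H|H].
  exact/QE.
exact/GRing.to_rformP/QE.
Qed.

Variable S : finType.

(* Variable number [enum_rank s] of a formula stands for the unknown indexed by [s]. *)
Definition valuation (e : seq K) (s : S) : K := e`_(enum_rank s).

Definition definable (P : (S -> K) -> Prop) : Prop :=
  exists f : GRing.formula K, forall e, GRing.holds e f <-> P (valuation e).

Definition term_function (F : (S -> K) -> K) : Prop :=
  exists t : GRing.term K, forall e, GRing.eval e t = F (valuation e).

Lemma term_function_const (a : K) : term_function (fun=> a).
Proof. by exists (GRing.Const a). Qed.

Lemma term_function_var (s : S) : term_function (fun z => z s).
Proof. by exists (GRing.Var K (enum_rank s)). Qed.

Lemma term_function_mul F G : term_function F -> term_function G ->
  term_function (fun z => F z * G z).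
Proof. by move=> [t Ht] [u Hu]; exists (GRing.Mul t u) => e /=; rewrite Ht Hu. Qed.

Lemma term_function_exp n F : term_function F -> term_function (fun z => F z ^+ n).
Proof. by move=> [t Ht]; exists (GRing.Exp t n) => e /=; rewrite Ht. Qed.

Lemma term_function_sum (I : finType) (F : I -> (S -> K) -> K) :
  (forall i, term_function (F i)) -> term_function (fun z => \sum_i F i z).
Proof.
move=> /fin_all_exists[t Ht]; exists (\big[@GRing.Add K/GRing.Const 0]_i t i) => e.
rewrite (big_morph (GRing.eval e) (id1 := 0) (op1 := +%R)) //.
by apply: eq_bigr => i _.
Qed.

Lemma definable_eq F G : term_function F -> term_function G ->
  definable (fun z => F z = G z).
Proof. by move=> [t Ht] [u Hu]; exists (GRing.Equal t u) => e /=; rewrite Ht Hu. Qed.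

Lemma definable_not P : definable P -> definable (fun z => ~ P z).
Proof.
by move=> [f Hf]; exists (GRing.Not f) => e /=; split=> H /Hf.
Qed.

Lemma definable_and P Q : definable P -> definable Q -> definable (fun z => P z /\ Q z).
Proof.
move=> [f Hf] [g Hg]; exists (GRing.And f g) => e /=.
by split=> -[/Hf ? /Hg ?].
Qed.

Lemma definable_guard (v : bool) P : definable P -> definable (fun z => v -> P z).
Proof.
move=> [f Hf]; exists (GRing.Implies (GRing.Bool v) f) => e /=.
by split=> H /H /Hf.
Qed.

Lemma definable_forall (I : finType) (P : I -> (S -> K) -> Prop) :
  (forall i, definable (P i)) -> definable (fun z => forall i, P i z).
Proof.
move=> /fin_all_exists[f Hf].
exists (foldr (fun i g => GRing.And (f i) g) (GRing.Bool true) (enum I)) => e.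
have [H1 H2] : GRing.holds e (foldr (fun i g => GRing.And (f i) g)
    (GRing.Bool true) (enum I)) <-> (forall i, i \in enum I -> P i (valuation e)).
  elim: (enum I) => [|j s [IH1 IH2]] //=; split=> [[/Hf Pj /IH1 Ps] i|H].
    by rewrite inE => /predU1P[->|/Ps].
  split; first by apply/Hf/H; rewrite mem_head.
  by apply: IH2 => i i_s; apply: H; rewrite inE i_s orbT.
by split=> [/H1 H i|H]; [apply: H; rewrite mem_enum | apply: H2].
Qed.

(** The variables in [B] are quantified existentially, those outside [B] and different from [k] act
    as parameters. *)
Lemma projection_nearly_constant (P : (S -> K) -> Prop) (k : S) (B : {set S}) :
    definable P -> k \notin B ->
  exists C : nat, forall z : S -> K, nearly_constant C (fun t => exists z',
    [/\ forall s, s \notin B -> s != k -> z' s = z s, z' k = t & P z']).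
Proof.
move=> [f Hf] kB; pose I := [seq nat_of_ord (enum_rank s) | s in B].
have [C HC] := holds_nearly_constant (foldr GRing.Exists f I) (enum_rank k).
exists C => z; pose e := [seq z s | s <- enum S].
have ez s : valuation e s = z s.
  rewrite /valuation /e (nth_map s) ?nth_enum_rank //.
  by rewrite -cardE ltn_ord.
have Hk s : (enum_rank s == enum_rank k :> nat) = (s == k).
  by rewrite val_eqE (inj_eq enum_rank_inj).
have HI s : (nat_of_ord (enum_rank s) \in I) = (s \in B).
  apply/imageP/idP => [[s' s'B /val_inj/enum_rank_inj ->]|sB] //.
  by exists s.
have [h [v [h0 sh E]]] := HC e; exists h, v; split=> // t /E <-.
split.
  move=> [z' [zz' <- Pz']]; apply/GRing.foldExistsP.
  pose n := #|S|.
  exists [seq (if j \in I then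
       if [pick s | (enum_rank s == j :> nat)] is Some s then z' s else 0
      else (set_nth 0 e (enum_rank k) (z' k))`_j) | j <- iota 0 n].
    move=> j; rewrite !inE => jI; case: (ltnP j n) => jn.
      by rewrite (nth_map 0%N) ?size_iota // nth_iota // add0n (negPf jI).
    rewrite !nth_default ?size_map ?size_iota // size_set_nth geq_max /e size_map.
    by rewrite -cardE jn andbT (leq_trans _ jn) // ltn_ord.
  apply/Hf; set e' := [seq _ | j <- _]; suff -> : valuation e' = z' by [].
  apply/funext => s; rewrite /valuation (nth_map 0%N) ?size_iota ?ltn_ord //.
  rewrite nth_iota ?ltn_ord // add0n HI; case: ifP => sB.
    case: pickP => [s' /eqP/val_inj/enum_rank_inj -> //|/(_ s)].
    by rewrite eqxx.
  rewrite nth_set_nth /= Hk; case: eqVneq => [-> //|sk].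
  by rewrite zz' ?sB //; apply: ez.
move/GRing.foldExistsP => [e' ee' /Hf Pe']; exists (valuation e'); split=> //.
  move=> s sB sk; rewrite -ez /valuation -ee' ?inE ?HI // nth_set_nth /= Hk.
  by rewrite (negPf sk).
by rewrite /valuation -ee' ?inE ?HI // nth_set_nth /= eqxx.
Qed.
End Definable.

(** * Polynomial functions and algebraic dependence *)

Lemma digits_lt (N M : nat) (f : nat -> nat) : (forall i, f i < N)%N ->
  (\sum_(i < M) f i * N ^ i < N ^ M)%N.
Proof.
move=> fN; elim: M => [|M IH]; first by rewrite big_ord0.
rewrite big_ord_recr /= expnS -addSn.
apply: leq_trans (_ : N ^ M + f M * N ^ M <= _)%N; first by rewrite leq_add2r.
by rewrite -mulSn leq_mul2r fN orbT.
Qed.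

Lemma digits_inj (N M : nat) (f g : nat -> nat) :
  (forall i, f i < N)%N -> (forall i, g i < N)%N ->
  (\sum_(i < M) f i * N ^ i = \sum_(i < M) g i * N ^ i)%N ->
  forall i, (i < M)%N -> f i = g i.
Proof.
move=> fN gN; elim: M => [|M IH] //; rewrite !big_ord_recr /= => E i.
have N0 : (0 < N ^ M)%N by rewrite expn_gt0 (leq_ltn_trans _ (fN 0%N)).
have fgM : f M = g M.
  move/(congr1 (fun n => n %/ N ^ M)%N): E.
  by rewrite ![(_ + _ * _)%N]addnC !divnMDl // !divn_small ?digits_lt // !addn0.
move: E; rewrite fgM => /addIn/IH{}IH.
by rewrite ltnS leq_eqVlt => /predU1P[->|/IH].
Qed.

Section PolynomialFunctions.
Variables (K : fieldType) (Y : finType).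
Implicit Types (F G : (Y -> K) -> K) (y : Y -> K).

Definition monomial (e : Y -> nat) y : K := \prod_s y s ^+ e s.

(** The bound is on the exponent of each variable separately, so that [d.+1 ^ #|Y|] monomials span
    these functions. *)
Definition exponents_le d F : Prop := exists a : {ffun Y -> 'I_d.+1} -> K,
  forall y, F y = \sum_e a e * monomial (fun s => e s) y.

Definition polynomial_function F : Prop := exists d, exponents_le d F.

Lemma exponents_le_ext d F G : F =1 G -> exponents_le d F -> exponents_le d G.
Proof. by move=> FG [a Ha]; exists a => y; rewrite -FG. Qed.

Lemma exponents_le_monomial d (e : Y -> nat) : (forall s, e s <= d)%N ->
  exponents_le d (monomial e).
Proof.
move=> ed; pose e1 : {ffun Y -> 'I_d.+1} := [ffun s => inord (e s)].
exists (fun e' => (e' == e1)%:R) => y.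
rewrite (bigD1 e1) //= eqxx mul1r big1 ?addr0; last first.
  by move=> e' /negPf ->; rewrite mul0r.
by apply: eq_bigr => s _; rewrite ffunE inordK // ltnS.
Qed.

Lemma exponents_le_scale d F (b : K) : exponents_le d F ->
  exponents_le d (fun y => b * F y).
Proof.
move=> [a Ha]; exists (fun e => b * a e) => y; rewrite Ha mulr_sumr.
by apply: eq_bigr => e _; rewrite mulrA.
Qed.

Lemma exponents_le_sum d (I : Type) (r : seq I) (P : pred I) (F : I -> (Y -> K) -> K) :
  (forall i, P i -> exponents_le d (F i)) ->
  exponents_le d (fun y => \sum_(i <- r | P i) F i y).
Proof.
move=> H; elim: r => [|i r [a Ha]].
  exists (fun=> 0) => y; rewrite big_nil big1 // => e _.
  by rewrite mul0r.
case Pi: (P i); last by exists a => y; rewrite big_cons Pi.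
have [b Hb] := H i Pi; exists (fun e => b e + a e) => y.
rewrite big_cons Pi Ha Hb -big_split /=.
by apply: eq_bigr => e _; rewrite mulrDl.
Qed.

Lemma exponents_le_mul d1 d2 F G : exponents_le d1 F -> exponents_le d2 G ->
  exponents_le (d1 + d2) (fun y => F y * G y).
Proof.
move=> [a Ha] [b Hb].
apply: (@exponents_le_ext _ (fun y => \sum_e \sum_(e' : {ffun Y -> 'I_d2.+1})
    (a e * b e') * monomial (fun s => e s + e' s)%N y)).
  move=> y; rewrite Ha Hb mulr_suml; apply: eq_bigr => e _.
  rewrite mulr_sumr; apply: eq_bigr => e' _.
  rewrite mulrACA /monomial -big_split /=; congr (_ * _).
  by apply: eq_bigr => s _; rewrite exprD.
apply: exponents_le_sum => e _; apply: exponents_le_sum => e' _.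
apply/exponents_le_scale/exponents_le_monomial => s.
by rewrite leq_add // -ltnS.
Qed.

Lemma exponents_le_const d (b : K) : exponents_le d (fun=> b).
Proof.
apply: (@exponents_le_ext _ (fun y => b * monomial (fun=> 0%N) y)).
  by move=> y; rewrite /monomial big1 ?mulr1.
by apply/exponents_le_scale/exponents_le_monomial.
Qed.

Lemma exponents_le_exp d n F : exponents_le d F ->
  exponents_le (n * d) (fun y => F y ^+ n).
Proof.
move=> HF; elim: n => [|n IH]; first exact: exponents_le_const.
rewrite mulSn; apply: exponents_le_ext (exponents_le_mul HF IH) => y.
by rewrite exprS.
Qed.

Lemma exponents_le_prod (I : Type) (r : seq I) (P : pred I) (d : I -> nat)
    (F : I -> (Y -> K) -> K) : (forall i, P i -> exponents_le (d i) (F i)) ->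
  exponents_le (\sum_(i <- r | P i) d i) (fun y => \prod_(i <- r | P i) F i y).
Proof.
move=> H; elim: r => [|i r IH].
  rewrite big_nil; apply: exponents_le_ext (exponents_le_const _ 1) => y.
  by rewrite big_nil.
rewrite big_cons; case Pi: (P i).
  by apply: exponents_le_ext (exponents_le_mul (H i Pi) IH) => y; rewrite big_cons Pi.
by apply: exponents_le_ext IH => y; rewrite big_cons Pi.
Qed.

Lemma exponents_le_leq d d' F : (d <= d')%N -> exponents_le d F -> exponents_le d' F.
Proof.
move=> dd' HF; rewrite -(subnKC dd').
apply: exponents_le_ext (exponents_le_mul HF (exponents_le_const _ 1)) => y.
by rewrite mulr1.
Qed.

Lemma polynomial_function_ext F G : F =1 G ->
  polynomial_function F -> polynomial_function G.
Proof. by move=> FG [d HF]; exists d; apply: exponents_le_ext HF. Qed.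

Lemma polynomial_function_const (b : K) : polynomial_function (fun=> b).
Proof. by exists 0; apply: exponents_le_const. Qed.

Lemma polynomial_function_var s : polynomial_function (fun y => y s).
Proof.
exists 1; apply: exponents_le_ext
    (exponents_le_monomial (d := 1) (e := fun s' => s' == s) _) => [y|s'].
  rewrite /monomial (bigD1 s) //= eqxx big1 ?mulr1 // => s' /negPf ->.
  by rewrite expr0.
by case: eqP.
Qed.

Lemma polynomial_function_mul F G : polynomial_function F -> polynomial_function G ->
  polynomial_function (fun y => F y * G y).
Proof.
by move=> [d HF] [d' HG]; exists (d + d')%N; apply: exponents_le_mul.
Qed.

Lemma polynomial_function_exp n F : polynomial_function F ->
  polynomial_function (fun y => F y ^+ n).
Proof. by move=> [d HF]; exists (n * d)%N; apply: exponents_le_exp. Qed.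

Lemma common_exponent_bound (I : finType) (P : pred I) (F : I -> (Y -> K) -> K) :
  (forall i, P i -> polynomial_function (F i)) ->
  exists d, forall i, P i -> exponents_le d (F i).
Proof.
move=> H.
have /fin_all_exists[d Hd] i : exists d, P i -> exponents_le d (F i).
  by case Pi: (P i); [have [d Hd] := H i Pi; exists d | exists 0%N].
exists (\max_i d i) => i Pi; apply: exponents_le_leq (Hd i Pi).
exact: leq_bigmax.
Qed.

Lemma polynomial_function_sum (I : finType) (P : pred I) (F : I -> (Y -> K) -> K) :
  (forall i, P i -> polynomial_function (F i)) ->
  polynomial_function (fun y => \sum_(i | P i) F i y).
Proof.
by move=> /common_exponent_bound[d Hd]; exists d; apply: exponents_le_sum.
Qed.

Lemma polynomial_function_prod (I : finType) (P : pred I) (F : I -> (Y -> K) -> K) :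
  (forall i, P i -> polynomial_function (F i)) ->
  polynomial_function (fun y => \prod_(i | P i) F i y).
Proof.
move=> /common_exponent_bound[d Hd].
by exists (\sum_(i | P i) d)%N; apply: exponents_le_prod.
Qed.

Lemma polynomial_function_add F G : polynomial_function F -> polynomial_function G ->
  polynomial_function (fun y => F y + G y).
Proof.
move=> HF HG; apply: (@polynomial_function_ext
    (fun y => \sum_(v : bool) (if v then F y else G y))).
  by move=> y; rewrite big_bool.
by apply: polynomial_function_sum => -[].
Qed.

Lemma polynomial_function_opp F : polynomial_function F ->
  polynomial_function (fun y => - F y).
Proof.
move=> HF; apply: polynomial_function_ext
  (polynomial_function_mul (polynomial_function_const (-1)) HF) => y.
by rewrite mulN1r.
Qed.

Lemma polynomial_function_det n (A : (Y -> K) -> 'M[K]_n) :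
  (forall i j, polynomial_function (fun y => A y i j)) ->
  polynomial_function (fun y => \det (A y)).
Proof.
move=> HA; apply: polynomial_function_sum => s _; apply: polynomial_function_mul.
  exact: polynomial_function_const.
by apply: polynomial_function_prod.
Qed.

Lemma polynomial_function_adj n (A : (Y -> K) -> 'M[K]_n) i j :
  (forall i j, polynomial_function (fun y => A y i j)) ->
  polynomial_function (fun y => (\adj (A y)) i j).
Proof.
move=> HA; apply: (@polynomial_function_ext (fun y => cofactor (A y) j i)).
  by move=> y; rewrite mxE.
apply: polynomial_function_mul; first exact: polynomial_function_const.
by apply: polynomial_function_det => k l; apply: polynomial_function_ext (HA _ _) => y;
  rewrite !mxE.
Qed.

(** The functions lie in the span of fewer than [#|I|] monomials, so the matrix of their
    coefficients has a nonzero left kernel vector. *)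
Lemma exists_linear_relation (I : finType) d (F : I -> (Y -> K) -> K) :
  (forall i, exponents_le d (F i)) -> (d.+1 ^ #|Y| < #|I|)%N ->
  exists2 b : I -> K, exists i, b i != 0 & forall y, \sum_i b i * F i y = 0.
Proof.
move=> /fin_all_exists[a Ha] dI.
pose E : finType := {ffun Y -> 'I_d.+1}.
pose A := \matrix_(i < #|I|, j < #|E|) a (enum_val i) (enum_val j).
have : kermx A != 0.
  rewrite -mxrank_eq0 mxrank_ker subn_eq0 -ltnNge.
  apply: leq_ltn_trans (rank_leq_col _) _.
  by rewrite card_ffun card_ord.
case/rowV0Pn => v /sub_kermxP vA v0.
exists (fun i => v 0 (enum_rank i)).
  have [j vj] : exists j, v 0 j != 0.
    apply/existsP; rewrite -negb_forall; apply: contra v0 => /forallP H.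
    by apply/eqP/rowP => j; rewrite mxE; apply/eqP/H.
  by exists (enum_val j); rewrite enum_valK.
move=> y; under eq_bigr => i _ do rewrite Ha mulr_sumr.
rewrite exchange_big big1 //= => e _.
under eq_bigr => i _ do rewrite mulrA.
rewrite -mulr_suml (_ : \sum_i _ = (v *m A) 0 (enum_rank e)).
  by rewrite vA mxE mul0r.
rewrite mxE (reindex _ (onW_bij _ (@enum_val_bij I))) /=.
by apply: eq_bigr => i _; rewrite !mxE enum_valK enum_rankK.
Qed.
End PolynomialFunctions.

Section Dependency.
Variable K : fieldType.

(** Kronecker substitution: monomials with exponents below [N] become distinct powers of [t]. *)
Definition moment_point (S : finType) (N : nat) (t : K) (s : S) : K :=
  t ^+ (N ^ enum_rank s).

Lemma sum_digits_inj (S : finType) (N : nat) :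
  injective (fun e : {ffun S -> 'I_N} => (\sum_s e s * N ^ enum_rank s)%N).
Proof.
case: N => [|N] e e' /= E; apply/ffunP => s.
  by case: (e s).
pose digit (e : {ffun S -> 'I_N.+1}) i := 
    if insub i is Some j then nat_of_ord (e (enum_val (j : 'I_#|S|))) else 0%N.
have sumE (f : {ffun S -> 'I_N.+1}) :
    (\sum_s f s * N.+1 ^ enum_rank s = \sum_(i < #|S|) digit f i * N.+1 ^ i)%N.
  rewrite (reindex _ (onW_bij _ (@enum_val_bij S))) /=; apply: eq_bigr => i _.
  by rewrite enum_valK /digit valK.
have dlt f i : (digit f i < N.+1)%N by rewrite /digit; case: insub.
move: E; rewrite !sumE => /(digits_inj (dlt e) (dlt e'))/(_ (enum_rank s) (ltn_ord _)).
by rewrite /digit valK enum_rankK => /val_inj.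
Qed.

(* [N] is the base of [moment_point] and [t] its parameter. *)
Definition generically (Q : nat -> K -> Prop) : Prop := exists N0 : nat,
  forall N, (N0 <= N)%N -> exists2 h : {poly K}, h != 0 &
    forall t, ~~ root h t -> Q N t.

Lemma generically_impl (Q Q' : nat -> K -> Prop) : (forall N t, Q N t -> Q' N t) ->
  generically Q -> generically Q'.
Proof.
move=> QQ' [N0 H]; exists N0 => N /H[h h0 Hh]; exists h => // t /Hh.
exact: QQ'.
Qed.

Lemma generically_forall (I : finType) (Q : I -> nat -> K -> Prop) :
  (forall i, generically (Q i)) -> generically (fun N t => forall i, Q i N t).
Proof.
move=> /fin_all_exists[N0 H]; exists (\max_i N0 i) => N HN.
have /fin_all_exists[h Hh] i : exists h : {poly K}, h != 0 /\
    forall t, ~~ root h t -> Q i N t.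
  have [|h h0 Hh] := H i N; last by exists h.
  by apply: leq_trans HN; apply: leq_bigmax.
exists (\prod_i h i) => [|t ht i].
  by apply/prodf_neq0 => i _; case: (Hh i).
case: (Hh i) => _; apply; apply: contra ht.
rewrite /root horner_prod => hit; apply/prodf_eq0.
by exists i.
Qed.

(* For [N] large there are more monomials with exponents below [N] in the coordinates
   of [u / v] than monomials spanning their numerators, hence a linear relation; at
   a moment point it becomes a polynomial in [t], nonzero because base-[N] expansions
   are unique. *)
Lemma generically_off_dominated (S Y : finType) (u : S -> (Y -> K) -> K)
    (v : (Y -> K) -> K) :
  (#|Y| < #|S|)%N -> (forall s, polynomial_function (u s)) -> polynomial_function v ->
  generically (fun N t => forall y, v y != 0 ->
    ~ (forall s, moment_point N t s * v y = u s y)).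
Proof.
move=> YS Hu [d0 Hv].
have [d1 Hd1] := common_exponent_bound (P := predT) (fun s _ => Hu s).
pose d := maxn d0 d1.
have {}Hu s : exponents_le d (u s) by apply: exponents_le_leq (Hd1 s isT); rewrite leq_maxr.
have {}Hv : exponents_le d v by apply: exponents_le_leq Hv; rewrite leq_maxl.
pose M := #|S|.
(* With this threshold [(M * N * d).+1 ^ #|Y| <= ((d * M).+1 * N) ^ #|Y| < N ^ #|Y|.+1 <= N ^ #|S|],
   so the monomials outnumber the dimension. *)
exists ((d * M).+1 ^ #|Y|).+1 => N HN.
have N0 : (0 < N)%N by apply: leq_ltn_trans HN.
pose w (e : {ffun S -> 'I_N}) := (\sum_s e s)%N.
have wM e : (w e <= M * N)%N.
  rewrite /w /M -sum_nat_const; apply: leq_sum => s _.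
  exact: ltnW.
(* Numerator of the monomial with exponents [e] in the [u s / v], over the common denominator
   [v ^+ (M * N)]. *)
pose F (e : {ffun S -> 'I_N}) y := v y ^+ (M * N - w e) * \prod_s u s y ^+ e s.
have HF e : exponents_le (M * N * d) (F e).
  rewrite -(subnK (wM e)) mulnDl; apply: exponents_le_mul.
    exact: exponents_le_exp.
  rewrite /w big_distrl /=; apply: exponents_le_prod => s _.
  exact: exponents_le_exp.
have [|b [e0 be0] Hb] := exists_linear_relation HF.
  rewrite card_ffun card_ord -/M.
  apply: leq_ltn_trans (_ : (((d * M).+1 * N) ^ #|Y| < _)%N).
    have: ((M * N * d).+1 <= (d * M).+1 * N)%N.
      by rewrite mulSn mulnAC [(M * d)%N]mulnC -add1n leq_add2r.
    by case: #|Y| => // k; rewrite leq_exp2r.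
  rewrite expnMn; apply: leq_trans (_ : N ^ #|Y|.+1 <= _)%N.
    by rewrite expnS ltn_pmul2r // expn_gt0 N0.
  by rewrite leq_pexp2l.
pose E (e : {ffun S -> 'I_N}) := (\sum_s e s * N ^ enum_rank s)%N.
pose h : {poly K} := \sum_e b e *: 'X^(E e).
have hE : h`_(E e0) = b e0.
  rewrite coef_sum (bigD1 e0) //= coefZ coefXn eqxx mulr1 big1 ?addr0 // => e ee0.
  rewrite coefZ coefXn; case: eqP => [/sum_digits_inj E0|]; last by rewrite mulr0.
  by rewrite E0 eqxx in ee0.
exists h; first by apply: contra be0 => /eqP h0; rewrite -hE h0 coef0.
move=> t ht y vy Ht; case/negP: ht; rewrite /root.
have /eqP := Hb y; rewrite (_ : \sum_e _ = v y ^+ (M * N) * h.[t]).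
  by rewrite mulf_eq0 expf_eq0 (negPf vy) andbF.
rewrite horner_sum mulr_sumr; apply: eq_bigr => e _.
rewrite hornerZ hornerXn [RHS]mulrCA; congr (_ * _).
rewrite /F; under eq_bigr => s _ do rewrite -Ht exprMn.
rewrite big_split /= -[in RHS](subnK (wM e)) exprD -mulrA; congr (_ * _).
rewrite /w prodrXr mulrC; congr (_ * _).
rewrite /E -prodrXr; apply: eq_bigr => s _.
by rewrite /moment_point -exprM mulnC.
Qed.
End Dependency.

(** * The algebraic graph *)

Section AlgebraicGraph.
Variables (K : fieldType) (m d I J : nat).

(* The coordinates of a right vertex [y] indexed by ['I_m] are determined by [x] and by
   the [d] others. *)
Definition coordinate : finType := ('I_m + 'I_d)%type.
(* Indices of the coefficients: the ['I_m] component names one of the [m] equations, the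
   others a linear form and a power of it. *)
Definition slot : finType := ('I_m * 'I_I * 'I_J)%type.
Definition free_coordinate : finType := (coordinate + 'I_d)%type.

Implicit Types (c : slot -> K) (x y : coordinate -> K).

Definition free_part x y (k : free_coordinate) : K :=
  match k with inl k => x k | inr k => y (inr k) end.

(** The value at [i] of the polynomial whose coefficients are the free coordinates of the edge. *)
Definition linear_form (i : nat) x y : K :=
  \sum_k free_part x y k * i%:R ^+ enum_rank k.

Definition alg_value c (l : 'I_m) x y : K :=
  \sum_(i < I) \sum_(j < J) c (l, i, j) * linear_form i x y ^+ j.

Definition alg_adj c x y : Prop := forall l, y (inl l) = alg_value c l x y.

Lemma alg_adj_free_inj c x y x' y' : alg_adj c x y -> alg_adj c x' y' ->
  free_part x y =1 free_part x' y' -> x =1 x' /\ y =1 y'.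
Proof.
move=> H H' F; have xx' k : x k = x' k by have := F (inl k).
split=> // -[l|k]; last by have := F (inr k).
rewrite H H'; apply: eq_bigr => i _; apply: eq_bigr => j _.
congr (_ * _ ^+ _).
by apply: eq_bigr => k _; rewrite F.
Qed.

(** Distinct edges give distinct polynomials of size at most [#|free_coordinate|]. The product of
    their pairwise differences has too few roots to vanish at all [I] distinct points. *)
Lemma separating_form (E : nat) (x y : 'I_E -> coordinate -> K) :
    injective (fun i : 'I_I => i%:R : K) ->
    (E * E * #|free_coordinate| < I)%N ->
    (forall e e', free_part (x e) (y e) =1 free_part (x e') (y e') -> e = e') ->
  exists i : 'I_I, injective (fun e => linear_form i (x e) (y e)).
Proof.
move=> charI EI Hinj.
pose f (e : 'I_E) : {poly K} := \sum_k free_part (x e) (y e) k *: 'X^(enum_rank k).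
have sf e : (size (f e) <= #|free_coordinate|)%N.
  apply: leq_trans (size_sum _ _ _) _; apply/bigmax_leqP => k _.
  apply: leq_trans (size_scale_leq _ _) _.
  by rewrite size_polyXn; apply: ltn_ord.
have fE e (i : 'I_I) : (f e).[i%:R] = linear_form i (x e) (y e).
  rewrite horner_sum; apply: eq_bigr => k _.
  by rewrite hornerZ hornerXn.
have f_inj e e' : f e = f e' -> e = e'.
  move=> ff; apply: Hinj => k; move/(congr1 (fun p : {poly K} => p`_(enum_rank k))): ff.
  have fk e1 : (f e1)`_(enum_rank k) = free_part (x e1) (y e1) k.
    rewrite coef_sum (bigD1 k) //= coefZ coefXn eqxx mulr1 big1 ?addr0 // => k' kk'.
    rewrite coefZ coefXn val_eqE (inj_eq enum_rank_inj) eq_sym (negPf kk').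
    by rewrite mulr0.
  by rewrite !fk.
have [ok|bad] := pselect (exists i : 'I_I, injective (fun e => linear_form i (x e) (y e))).
  exact: ok.
pose P := \prod_(q : 'I_E * 'I_E | q.1 != q.2) (f q.1 - f q.2).
have P0 : P != 0.
  apply/prodf_neq0 => q nq.
  by rewrite subr_eq0; apply: contra nq => /eqP/f_inj/eqP.
have /(max_poly_roots P0) : all (root P) [seq (i : 'I_I)%:R | i <- enum 'I_I].
  apply/allP => _ /mapP[i _ ->]; rewrite /root horner_prod.
  have /existsNP[e /existsNP[e' /not_implyP[ee' nee']]] :
      ~ injective (fun e => linear_form i (x e) (y e)) by move=> H; apply: bad; exists i.
  apply/prodf_eq0; exists (e, e') => /=; first exact/eqP.
  by rewrite hornerD hornerN !fE /= ee' subrr.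
rewrite map_inj_uniq ?enum_uniq // size_map size_enum_ord => /(_ isT).
rewrite ltnNge => /negP[]; apply: leq_trans EI.
apply: leq_trans (size_poly_prod_leq _ _) _; apply: leq_trans (leq_subr _ _) _.
rewrite ltnS; apply: leq_trans (_ : \sum_(q : 'I_E * 'I_E) #|free_coordinate| <= _)%N.
  rewrite [leqLHS]big_mkcond; apply: leq_sum => q _; case: ifP => // _.
  by apply: leq_trans (size_polyD _ _) _; rewrite size_polyN geq_max !sf.
by rewrite sum_nat_const card_prod !card_ord.
Qed.

Section FixedPattern.
Variables (E n a : nat) (A : 'I_a -> K).
Variable g : {ffun 'I_E * bool * coordinate -> 'I_n + 'I_a}.

(** The pattern [g] assigns to each coordinate of the left ([false]) and right ([true]) end of each
    edge an unknown or a constant from [A]. Patterns are finite in number, so a generic choice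
    handles all of them at once. *)
Definition pattern_point (Y : 'I_n -> K) (e : 'I_E) (v : bool) (k : coordinate) : K :=
  match g (e, v, k) with inl r => Y r | inr r => A r end.

(** All coefficients are rational functions of the [n] unknowns and the coefficients that are not
    pivots. As there are [m * E > n] pivots, these parameters are fewer than the coefficients. *)
Lemma generically_no_pattern (i : 'I_I) : (E <= J)%N -> (n < m * E)%N ->
  generically (fun N t => forall Y : 'I_n -> K,
    injective (fun e => linear_form i (pattern_point Y e false) (pattern_point Y e true)) ->
    ~ forall e, alg_adj (moment_point N t) (pattern_point Y e false) (pattern_point Y e true)).
Proof.
move=> EJ nE.
(* The equations determine the coefficients of the first [E] powers of the [i]-th
   linear form by inverting a Vandermonde matrix. *)
pose pivot := [pred s : slot | (s.1.2 == i) && (s.2 < E)%N].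
pose Z : finType := ('I_n + {s : slot | ~~ pivot s})%type.
pose pp (z : Z -> K) := pattern_point (z \o inl).
pose lam j z e := linear_form j (pp z e false) (pp z e true).
pose V z : 'M[K]_E := \matrix_(e, j) lam i z e ^+ j.
(* [insub] fails exactly at pivots, so [rest] subtracts only the terms that are not pivots. *)
pose rest z l e := pp z e true (inl l) - \sum_(i' < I) \sum_(j < J)
  (if insub (l, i', j) is Some s then z (inr s) else 0) * lam i' z e ^+ j.
(* Numerators over the common denominator [\det (V z)]: Cramer's rule at a pivot, where the sum over
   [k] has a single term, and plain rescaling elsewhere. *)
pose u (s : slot) z := if insub s is Some s' then \det (V z) * z (inr s') else
  \sum_(k < E | k == s.2 :> nat) \sum_e \adj (V z) k e * rest z s.1.1 e.
have p_pp e v k : polynomial_function (fun z => pp z e v k).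
  rewrite /pp /pattern_point; case: (g _) => r; first exact: polynomial_function_var.
  exact: polynomial_function_const.
have p_lam j e : polynomial_function (fun z => lam j z e).
  apply: polynomial_function_sum => k _.
  apply: polynomial_function_mul; last exact: polynomial_function_const.
  by case: k => [k|k] /=.
have p_V e j : polynomial_function (fun z => V z e j).
  apply: (@polynomial_function_ext _ _ (fun z => lam i z e ^+ j)).
    by move=> z; rewrite mxE.
  exact: polynomial_function_exp.
have p_rest l e : polynomial_function (fun z => rest z l e).
  apply: polynomial_function_add => //; apply: polynomial_function_opp.
  apply: polynomial_function_sum => i' _; apply: polynomial_function_sum => j _.
  apply: polynomial_function_mul; last exact: polynomial_function_exp.
  case: insub => [s|]; first exact: polynomial_function_var.
  exact: polynomial_function_const.
have p_u s : polynomial_function (u s).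
  rewrite /u; case: insub => [s'|].
    apply: polynomial_function_mul; last exact: polynomial_function_var.
    exact: polynomial_function_det.
  apply: polynomial_function_sum => k _; apply: polynomial_function_sum => e _.
  apply: polynomial_function_mul => //.
  exact: polynomial_function_adj.
have ZS : (#|Z| < #|slot|)%N.
  rewrite card_sum card_ord card_sig -(cardC pivot) ltn_add2r.
  apply: leq_trans nE _.
  pose q (w : 'I_m * 'I_E) : slot := (w.1, i, widen_ord EJ w.2).
  have q_inj : injective q.
    by move=> [l e] [l' e'] [-> ee']; congr (_, _); apply: val_inj.
  have := card_codom q_inj; rewrite card_prod !card_ord => <-.
  apply: subset_leq_card; apply/subsetP => _ /codomP[w ->].
  by rewrite inE /= eqxx ltn_ord.
apply: generically_impl (generically_off_dominated ZS p_u (polynomial_function_det p_V)).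
move=> N t H Y Y_inj Hadj; pose c := moment_point N t : slot -> K.
pose z (w : Z) := match w with inl r => Y r | inr s => c (val s) end.
have detV : \det (V z) != 0.
  pose al := \row_e lam i z e.
  rewrite (_ : V z = (Vandermonde E al)^T); last by apply/matrixP => e j; rewrite !mxE.
  rewrite det_tr det_Vandermonde; apply/prodf_neq0 => e _; apply/prodf_neq0 => e' ee'.
  rewrite !mxE subr_eq0; apply: contraTneq ee' => /Y_inj ->.
  by rewrite ltnn.
apply: (H z detV) => s; rewrite /u mulrC; case: insubP => [s' _ <- //|].
rewrite negbK => /andP[/eqP si sE]; case: s si sE => -[l _] j /= -> jE.
have restE e : rest z l e = \sum_(k < E) V z e k * c (l, i, widen_ord EJ k).
  rewrite /rest [pp _ _ _ _]Hadj /alg_value -sumrB (bigD1 i) //= [X in _ + X]big1 ?addr0.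
    rewrite -sumrB (bigID (fun k : 'I_J => k < E)%N) /= [X in _ + X]big1 ?addr0.
      rewrite big_ord_narrow; apply: eq_bigr => k _; rewrite insubF.
        by rewrite mul0r subr0 mxE mulrC.
      by rewrite /= eqxx ltn_ord.
    move=> k kE; rewrite insubT /=; first by rewrite eqxx.
    by move=> kp; apply: subrr.
  move=> i' i'i; rewrite -sumrB big1 // => k _; rewrite insubT /=.
    by rewrite (negPf i'i).
  by move=> kp; apply: subrr.
rewrite (big_pred1 (Ordinal jE)) => [|k]; last exact: (val_eqE k (Ordinal jE)).
under eq_bigr => e _ do rewrite restE mulr_sumr.
rewrite exchange_big /= (bigD1 (Ordinal jE)) //= [X in _ + X]big1 ?addr0 => [|k kj].
  under eq_bigr => e _ do rewrite mulrA.
  rewrite -mulr_suml (_ : \sum_e _ = (\adj (V z) *m V z) (Ordinal jE) (Ordinal jE)).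
    rewrite mul_adj_mx mxE eqxx mulr1n; congr (_ * c (_, _, _)).
    exact: val_inj.
  by rewrite [RHS]mxE.
under eq_bigr => e _ do rewrite mulrA.
rewrite -mulr_suml (_ : \sum_e _ = (\adj (V z) *m V z) (Ordinal jE) k).
  by rewrite mul_adj_mx mxE eq_sym (negPf kj) mul0r.
by rewrite [RHS]mxE.
Qed.
End FixedPattern.

Definition point := {ffun coordinate -> K}.

(** Genericity is imposed for every number of edges, number of unknowns, linear form and pattern. A
    given list of edges realizes one pattern, and [separating_form] supplies the linear form. *)
Lemma generically_sparse (Emax : nat) (A : seq K) :
    injective (fun i : 'I_I => i%:R : K) -> (Emax <= J)%N ->
    (Emax * Emax * #|free_coordinate| < I)%N ->
  generically (fun N t => forall (es : seq (point * point)) (Y : seq K),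
    uniq es -> (size es <= Emax)%N -> (size Y < m * size es)%N ->
    (forall e, e \in es -> forall k, e.1 k \in Y ++ A /\ e.2 k \in Y ++ A) ->
    ~ forall e, e \in es -> alg_adj (moment_point N t) e.1 e.2).
Proof.
move=> charI EJ EI.
have G : generically (fun N t => forall (E : 'I_Emax.+1) (n : 'I_(m * Emax.+1)) (i : 'I_I)
   (g : {ffun 'I_E * bool * coordinate -> 'I_n + 'I_(size A)}),
   (n < m * E)%N -> forall Y : 'I_n -> K,
    let p := pattern_point (tnth (in_tuple A)) g Y in
    injective (fun e => linear_form i (p e false) (p e true)) ->
    ~ forall e, alg_adj (moment_point N t) (p e false) (p e true)).
  apply: generically_forall => E; apply: generically_forall => n.
  apply: generically_forall => i; apply: generically_forall => g.
  case nE: (n < m * E)%N; last by exists 0 => N _; exists 1; rewrite ?oner_eq0.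
  have EJ' : (E <= J)%N by apply: leq_trans EJ; rewrite -ltnS.
  apply: generically_impl (generically_no_pattern (tnth (in_tuple A)) g i EJ' nE).
  by move=> N t H _ Y p; apply: H.
apply: generically_impl G => N t G es Y es_uniq esE Yes Hco Hadj.
pose E := size es; pose n := size Y.
have EE : (E < Emax.+1)%N by rewrite ltnS.
have nn : (n < m * Emax.+1)%N.
  by apply: leq_trans Yes _; rewrite leq_mul2l (leq_trans esE) ?orbT.
pose ee (e : 'I_E) := tnth (in_tuple es) e.
have ees e : ee e \in es by apply: mem_tnth.
pose px (e : 'I_E) (v : bool) : coordinate -> K := if v then (ee e).2 else (ee e).1.
have /fin_all_exists[g0 Hg0] (w : 'I_E * bool * coordinate) : exists o : 'I_n + 'I_(size A),
    px w.1.1 w.1.2 w.2 = match o with inl r => tnth (in_tuple Y) r | inr r => tnth (in_tuple A) r end.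
  have : px w.1.1 w.1.2 w.2 \in Y ++ A.
    have [H1 H2] := Hco _ (ees w.1.1) w.2.
    by rewrite /px; case: (w.1.2).
  rewrite mem_cat => /orP[/(tnthP (in_tuple Y))|/(tnthP (in_tuple A))] [r ->].
    by exists (inl r).
  by exists (inr r).
pose g := [ffun w => g0 w].
have pE e v : pattern_point (tnth (in_tuple A)) g (tnth (in_tuple Y)) e v = px e v.
  by apply/funext => k; rewrite /pattern_point ffunE (Hg0 (e, v, k)).
have Hpx e : alg_adj (moment_point N t) (px e false) (px e true) by apply: Hadj.
have [||i Hi] := @separating_form E (px^~ false) (px^~ true) charI.
- apply: leq_ltn_trans EI; rewrite leq_mul2r.
  by rewrite leq_mul ?orbT.
- move=> e e' /(alg_adj_free_inj (Hpx e) (Hpx e'))[H1 H2].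
  have : ee e = ee e'.
    by rewrite [LHS]surjective_pairing [RHS]surjective_pairing; congr pair; apply/ffunP.
  by move: (@tuple_uniqP _ _ (in_tuple es)) => /elimT; apply.
apply: (G (Ordinal EE) (Ordinal nn) i g Yes (tnth (in_tuple Y))) => /= [e e'|e].
  by rewrite !pE; apply: Hi.
by rewrite !pE.
Qed.

End AlgebraicGraph.

(** * Copies of the tree in the algebraic graph *)

Section Copies.
Variables (K : closedFieldType) (V : finType) (T : sgraph V) (roots : {set V}).
Variables (d I J : nat).
Let m := #|~: roots|.
Let b := (m + d)%N.
(** Balancedness with denominators cleared; in the application [d] makes [b] the number of edges of
    [T]. *)
Hypothesis dense : forall S : {set V}, S \subset ~: roots ->
  (b * #|S| <= m * #|[set e in edges T | e :&: S != set0]|)%N.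

Notation coord := (coordinate m d).
Notation pt := (point K m d).
Implicit Types (c : slot m I J -> K) (sg : V -> bool) (w x : V -> coord -> K).

(* [sg v] tells whether [v] is placed on the right side of the bipartite graph. *)
Definition alg_copy c sg w : Prop :=
  (forall u v, sg u = sg v -> w u =1 w v -> u = v) /\
  (forall u v, adj T u v -> sg u != sg v /\ (~~ sg u -> alg_adj c (w u) (w v))).

(** Each edge imposes [m] equations, so this forbids small overdetermined sets of edges, coordinates
    in [A] counting as known. *)
Definition sparse (Emax : nat) (A : seq K) c : Prop :=
  forall (es : seq (pt * pt)) (Y : seq K),
    uniq es -> (size es <= Emax)%N -> (size Y < m * size es)%N ->
    (forall e, e \in es -> forall k, e.1 k \in Y ++ A /\ e.2 k \in Y ++ A) ->
    ~ forall e, e \in es -> alg_adj c e.1 e.2.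

Lemma card_coordinate : #|{: coord}| = b.
Proof. by rewrite card_sum !card_ord. Qed.

(* The roots use up to [#|roots| * b] coordinates, and each copy gains one equation. *)
Definition copies_needed := (#|roots| * b).+1.

(** Bounds the number of coordinates of all points met by the greedy selection: the roots and each
    copy contribute at most [#|V|] points. *)
Definition value_bound := (copies_needed.+1 * #|V| * b)%N.

(** Each edge is oriented from its left end to its right end. *)
Lemma edges_touching_le sg (S : {set V}) :
  (forall u v, adj T u v -> sg u != sg v) ->
  (#|[set e in edges T | e :&: S != set0]| <=
   #|[set uv : V * V | [&& adj T uv.1 uv.2, ~~ sg uv.1 & (uv.1 \in S) || (uv.2 \in S)]]|)%N.
Proof.
move=> Hsg; set Q := [set uv : V * V | _].
apply: (@leq_trans #|[set [set uv.1; uv.2] | uv in Q]|); last exact: leq_imset_card.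
apply/subset_leq_card/subsetP => e; rewrite inE => /andP[eT /set0Pn[z]].
rewrite inE => /andP[ze zS].
have /cards2P[u [v [uv def_e]]] := forall_inP (edges_card2 T) e eT.
have uvS : (u \in S) || (v \in S).
  by move: ze; rewrite def_e !inE => /orP[] /eqP <-; rewrite zS ?orbT.
have Tuv : adj T u v by rewrite /adj -def_e.
case su: (sg u); last first.
  by apply/imsetP; exists (u, v) => //; rewrite inE /= Tuv su.
apply/imsetP; exists (v, u); last by rewrite def_e setUC.
rewrite inE /= orbC uvS andbT /adj setUC -/(adj T u v) Tuv /=.
by have := Hsg u v Tuv; rewrite su; case: (sg v).
Qed.

(** [es] collects edges, [Z] their ends tagged by side, and [Y] coordinate values so that [Y ++ A]
    covers all of [Z]. Every round gains one in [m * size es - size Y]. *)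
Lemma greedy_copies c sg x (u0 : V) (k0 : coord) (A B : seq K) :
    u0 \notin roots -> uniq B -> {subset B <= A} -> (value_bound < size B)%N ->
    (forall t, t \in B -> exists w,
      [/\ alg_copy c sg w, {in roots, forall v, w v =1 x v} & w u0 k0 = t]) ->
  forall j, (j <= copies_needed)%N ->
  exists (es : seq (pt * pt)) (Z : seq (bool * pt)) (Y : seq K),
  [/\ uniq es /\ (forall e, e \in es ->
        [/\ alg_adj c e.1 e.2, (false, e.1) \in Z & (true, e.2) \in Z]),
      forall z, z \in Z -> forall k, z.2 k \in Y ++ A,
      {in roots, forall v, (sg v, [ffun k => x v k]) \in Z},
      (size es <= j * #|V| ^ 2)%N /\ (size Z <= j.+1 * #|V|)%N
    & (size Y + j <= #|roots| * b + m * size es)%N].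
Proof.
move=> u0R B_uniq BA sB HB; elim=> [_|j IH jc].
  exists [::], [seq (sg v, [ffun k => x v k]) | v in roots],
    [seq x vk.1 vk.2 | vk in setX roots [set: coord]]; split=> //.
  - move=> _ /imageP[v vR ->] k; rewrite mem_cat; apply/orP; left.
    by apply/imageP; exists (v, k); rewrite ?inE ?vR ?ffunE.
  - by move=> v vR; apply/imageP; exists v.
  - by split=> //; rewrite size_image mul1n max_card.
  - by rewrite size_image cardsX cardsT card_coordinate !addn0 leq_addr.
have [es [Z [Y [[es_uniq Hes] HZ HR [ses sZ] sY]]]] := IH (ltnW jc).
(* A value not yet seen as a coordinate forces the image of [u0] to be a new point. *)
have [t tB tZ] : exists2 t, t \in B &
    t \notin [seq p.2 k | p : bool * pt <- Z, k : coord <- enum (coord)].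
  apply/hasP; rewrite has_predC; apply/negP => /allP H.
  have := leq_trans sB (uniq_leq_size B_uniq H).
  rewrite size_allpairs -cardE card_coordinate ltnNge leq_mul2r.
  apply/negP/negPn/orP; right; apply: leq_trans sZ _.
  by rewrite leq_mul2r ltnS (ltnW jc) orbT.
have [w [[w_inj w_adj] wR wt]] := HB t tB.
pose pw v : pt := [ffun k => w v k]; pose P v := (sg v, pw v).
pose S := [set v | P v \notin Z].
have SR : S \subset ~: roots.
  apply/subsetP => v; rewrite !inE; apply: contra => vR.
  rewrite (_ : P v = (sg v, [ffun k => x v k])) ?HR //.
  by congr pair; apply/ffunP => k; rewrite !ffunE wR.
have u0S : u0 \in S.
  rewrite inE; apply: contra tZ => PZ; apply/allpairsP; exists (P u0, k0).
  by rewrite PZ mem_enum /= ffunE wt.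
pose Q := [set uv : V * V | [&& adj T uv.1 uv.2, ~~ sg uv.1 & (uv.1 \in S) || (uv.2 \in S)]].
pose es' := [seq (pw uv.1, pw uv.2) | uv in Q].
have pw_inj u v : sg u = sg v -> pw u = pw v -> u = v.
  by move=> suv /ffunP puv; apply: w_inj => // k; have := puv k; rewrite !ffunE.
have inZ v : v \notin S -> P v \in Z by rewrite inE negbK.
have ses' : size es' = #|Q| by rewrite size_image.
have sgQ u v : adj T u v -> ~~ sg u -> sg v.
  by move=> /w_adj[]; case: (sg u); case: (sg v).
(* The coordinate [(u0, k0)] is left out of [Y] because its value [t] already lies in [A]; this is
   the gain of one. *)
exists (es ++ es'), (Z ++ [seq P v | v in S]), (Y ++
    [seq w vk.1 vk.2 | vk in setX S [set: coord] :\ (u0, k0)]); split.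
- split.
    rewrite cat_uniq es_uniq /=; apply/andP; split.
      apply/hasPn => e /imageP[[u v] /=]; rewrite inE /= => /and3P[Tuv su uvS] ->.
      apply/negP => /Hes[_ /= Zu Zv]; case/orP: uvS; rewrite inE.
        by rewrite /P (negPf su) Zu.
      by rewrite /P (sgQ _ _ Tuv su) Zv.
    rewrite map_inj_in_uniq ?enum_uniq // => -[u v] [u' v'].
    rewrite !mem_enum !inE /= => /and3P[Tuv su _] /and3P[Tuv' su' _] [puu pvv].
    congr pair; apply: pw_inj => //.
      by rewrite (negPf su) (negPf su').
    by rewrite (sgQ _ _ Tuv su) (sgQ _ _ Tuv' su').
  move=> e; rewrite mem_cat => /orP[/Hes[ac eZ1 eZ2]|].
    by rewrite !mem_cat eZ1 eZ2; split.
  case/imageP => -[u v]; rewrite inE /= => /and3P[Tuv su _] -> /=.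
  have PZ z : P z \in Z ++ [seq P v | v in S].
    rewrite mem_cat; case zS: (z \in S); last by rewrite inZ ?zS.
    by apply/orP; right; apply/imageP; exists z.
  split; last 1 first.
  - by have := PZ v; rewrite {1}/P (sgQ _ _ Tuv su).
  - have [_ /(_ su) H] := w_adj u v Tuv.
    have -> : fun_of_fin (pw u) = w u by apply/funext => k; rewrite ffunE.
    by have -> : fun_of_fin (pw v) = w v by apply/funext => k; rewrite ffunE.
  - by have := PZ u; rewrite {1}/P (negPf su).
- move=> z; rewrite mem_cat => /orP[/HZ H k|/imageP[v vS -> k]].
    by have := H k; rewrite !mem_cat -orbA => /orP[->|->]; rewrite ?orbT.
  rewrite /= ffunE !mem_cat; case: (eqVneq (v, k) (u0, k0)) => [[-> ->]|vk].
    by rewrite wt BA ?orbT.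
  rewrite -orbA orbCA; apply/orP; left; apply/imageP; exists (v, k) => //.
  by rewrite in_setD1 in_setX in_setT vk vS.
- by move=> v /HR H; rewrite mem_cat H.
- split; rewrite size_cat.
    rewrite ses' mulSn addnC leq_add // -mulnn -card_prod.
    exact: max_card.
  by rewrite mulSn addnC leq_add // size_image max_card.
- rewrite !size_cat ses' size_image.
  have -> : #|setX S [set: coord] :\ (u0, k0)| = (b * #|S|).-1.
    rewrite mulnC -card_coordinate -cardsT -cardsX [in RHS](cardsD1 (u0, k0)).
    by rewrite in_setX in_setT u0S.
  have b0 : (0 < b)%N by rewrite -card_coordinate; apply/card_gt0P; exists k0.
  have S0 : (0 < b * #|S|)%N by rewrite muln_gt0 b0; apply/card_gt0P; exists u0.
  have HQ : (b * #|S| <= m * #|Q|)%N.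
    apply: leq_trans (dense SR) _; rewrite leq_mul2l.
    by rewrite edges_touching_le ?orbT // => u v /w_adj[].
  move: S0 HQ sY; rewrite mulnDr.
  move: (b * #|S|)%N (m * #|Q|)%N (m * size es)%N (#|roots| * b)%N (size Y).
  by clear; lia.
Qed.

(** After [copies_needed] rounds the gain exceeds the initial [#|roots| * b] values, against
    sparsity. *)
Lemma few_values c sg x (u0 : V) (k0 : coord) (A B : seq K) :
    u0 \notin roots -> sparse (copies_needed * #|V| ^ 2) A c ->
    uniq B -> {subset B <= A} ->
    (forall t, t \in B -> exists w,
      [/\ alg_copy c sg w, {in roots, forall v, w v =1 x v} & w u0 k0 = t]) ->
  (size B <= value_bound)%N.
Proof.
move=> u0R Hc B_uniq BA HB; rewrite leqNgt; apply/negP => sB.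
have [es [Z [Y [[es_uniq Hes] HZ _ [ses _] sY]]]] :=
  greedy_copies u0R B_uniq BA sB HB (leqnn _).
apply: (Hc es Y es_uniq ses).
- by move: sY; rewrite /copies_needed addnS [(size Y + _)%N]addnC ltn_add2l.
- by move=> e /Hes[_ /HZ H1 /HZ H2] k.
- by move=> e /Hes[].
Qed.

(** The coefficients are formula variables along with the coordinates of the copy, which makes the
    bounds uniform in them. *)
Let S : finType := (slot m I J + V * coord)%type.
Let coeff_of (z : S -> K) : slot m I J -> K := fun s => z (inl s).
Let place_of (z : S -> K) : V -> coord -> K := fun v k => z (inr (v, k)).

Lemma definable_alg_copy sg : definable (fun z : S -> K => alg_copy (coeff_of z) sg (place_of z)).
Proof.
have tv s : term_function (fun z : S -> K => z s) by apply: term_function_var.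
apply: definable_and.
  apply: definable_forall => u; apply: definable_forall => v.
  have [suv|suv] := eqVneq (sg u) (sg v); last first.
    by exists (GRing.Bool true) => e; split=> // _ E; rewrite E eqxx in suv.
  have [uv|uv] := eqVneq u v; first by exists (GRing.Bool true).
  have [f Hf] : definable (fun z : S -> K => ~ forall k, place_of z u k = place_of z v k).
    apply: definable_not; apply: definable_forall => k.
    by apply: definable_eq; apply: tv.
  exists f => e; rewrite Hf; split=> [H _ /H //|H /(H suv) E].
  by rewrite E eqxx in uv.
apply: definable_forall => u; apply: definable_forall => v.
apply: definable_guard; apply: definable_and.
  by exists (GRing.Bool (sg u != sg v)).
apply: definable_guard; apply: definable_forall => l; apply: definable_eq; first exact: tv.
apply: term_function_sum => i; apply: term_function_sum => j.
apply: term_function_mul; first exact: tv; apply: term_function_exp; apply: term_function_sum => k.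
apply: term_function_mul; last exact: term_function_const.
by case: k => k; apply: tv.
Qed.

Lemma exists_notin (s : seq K) : exists a, a \notin s.
Proof.
have /closed_nonrootP[a] : \prod_(a <- s) ('X - a%:P) != 0 :> {poly K}.
  by apply/monic_neq0/monic_prod_XsubC.
by rewrite root_prod_XsubC; exists a.
Qed.

Lemma exists_uniq_seq (n : nat) : exists2 s : seq K, uniq s & size s = n.
Proof.
elim: n => [|n [s us ss]]; first by exists [::].
have [a a_s] := exists_notin s.
by exists (a :: s) => /=; rewrite ?a_s ?ss.
Qed.

(** The values form a finite or cofinite set, with a bound on the exceptions that is fixed before
    [A]. If the set were cofinite, more than [value_bound] elements of [A] would be values, against
    [few_values]. *)
Lemma coordinate_values_bounded : exists (A : seq K) (C : nat), forall c,
    sparse (copies_needed * #|V| ^ 2) A c ->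
  forall sg x (u0 : V) (k0 : coord), u0 \notin roots ->
  exists h : {poly K}, [/\ h != 0, (size h <= C)%N & forall w, alg_copy c sg w ->
    {in roots, forall v, w v =1 x v} -> root h (w u0 k0)].
Proof.
(* The coordinates of unrooted vertices other than the one under study are projected away. *)
pose B (q : {ffun V -> bool} * V * coord) : {set S} :=
  [set s | if s is inr (v, k) then (v \notin roots) && ((v, k) != (q.1.2, q.2)) else false].
have /fin_all_exists[C HC] q : exists C, forall z : S -> K, nearly_constant C (fun t =>
    exists z', [/\ forall s, s \notin B q -> s != inr (q.1.2, q.2) -> z' s = z s,
      z' (inr (q.1.2, q.2)) = t
    & alg_copy (coeff_of z') q.1.1 (place_of z')]).
  apply: projection_nearly_constant; first exact: definable_alg_copy.
  by rewrite inE eqxx andbF.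
have [A A_uniq sA] := exists_uniq_seq (value_bound + \max_q C q).+1.
exists A, (\max_q C q) => c Hc sg x u0 k0 u0R.
pose q := ([ffun v => sg v], u0, k0) : {ffun V -> bool} * V * coord.
have sgE : fun_of_fin q.1.1 = sg by apply/funext => v; rewrite ffunE.
pose z (s : S) := match s with inl s => c s | inr (v, k) => x v k end.
have [h [v [h0 sh E]]] := HC q z; rewrite sgE in E.
have {}sh : (size h <= \max_q C q)%N by apply: leq_trans sh (leq_bigmax q).
have v_false : v = false.
  apply/negP => vt; have := @few_values c sg x u0 k0 A [seq t <- A | ~~ root h t] u0R Hc.
  rewrite filter_uniq // => /(_ isT) H.
  have : (size [seq t <- A | ~~ root h t] <= value_bound)%N.
    apply: H => [t|t]; first by rewrite mem_filter => /andP[].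
    rewrite mem_filter => /andP[/E[_ H] _]; have [z' [z'z z'k z'c]] := H vt.
    exists (place_of z'); split=> //.
      have <- // : coeff_of z' = c.
      by apply/funext => s; rewrite /coeff_of z'z // inE.
    move=> r rR k; rewrite /place_of z'z ?inE ?rR //.
    by apply: contraNneq u0R => -[<-].
  have : all (root h) [seq t <- A | root h t] by apply: filter_all.
  move=> /(max_poly_roots h0) /(_ (filter_uniq _ A_uniq)) H1 H2.
  have H3 : (size [seq t <- A | root h t] + size [seq t <- A | ~~ root h t] =
      (value_bound + \max_q C q).+1)%N by rewrite !size_filter (count_predC (root h) A).
  have := leq_add (leq_trans H1 sh) H2.
  by rewrite addSn H3 [leqRHS]addnC leqNgt leqnSn.
exists h; split=> // w wc wx; apply: contraT => /E[H _].
rewrite -v_false; apply: H.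
exists (fun s => match s with inl s => c s | inr (v, k) => w v k end); split=> //.
case=> [//|[r k]]; rewrite inE => H1 H2; apply: wx.
by move: H1; rewrite negb_and negbK (inj_eq (@inr_inj _ _)) in H2 *; rewrite H2 orbF.
Qed.

(** A copy is determined by its sides and, for each coordinate, the position of its value in the
    list of values taken by the copies with the same sides. *)
Lemma copies_bounded : exists (A : seq K) (C : nat), forall c,
    sparse (copies_needed * #|V| ^ 2) A c ->
  forall p (sg : 'I_p -> V -> bool) (w : 'I_p -> V -> coord -> K),
    (forall i, alg_copy c (sg i) (w i)) ->
    (forall i j, {in roots, forall v, w i v =1 w j v}) ->
    (forall i j, (forall v, sg i v = sg j v /\ w i v =1 w j v) -> i = j) ->
  (p <= C)%N.
Proof.
have [A [C HA]] := coordinate_values_bounded.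
exists A, #|{: {ffun V -> bool} * {ffun V * coord -> 'I_C.+1}}| => c /HA{}HA p sg w wc wR w_inj.
pose L i v k := undup [seq w j v k | j <- enum 'I_p & [forall u, sg i u == sg j u]].
have wL i v k : w i v k \in L i v k.
  rewrite mem_undup; apply: map_f; rewrite mem_filter mem_enum andbT.
  by apply/forallP.
(* The bound [C.+1] also covers roots, where all copies share one value. *)
have sL i v k : (size (L i v k) <= C.+1)%N.
  have [vR|vR] := boolP (v \in roots).
    apply: leq_trans (_ : size [:: w i v k] <= _)%N => //.
    apply: uniq_leq_size; first exact: undup_uniq.
    by move=> t; rewrite mem_undup => /mapP[j _ ->]; rewrite inE; apply/eqP/wR.
  have [h [h0 sh Hh]] := HA (sg i) (w i) v k vR.
  apply/leqW/ltnW/(leq_trans _ sh)/(max_poly_roots h0); last exact: undup_uniq.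
  apply/allP => t; rewrite mem_undup => /mapP[j].
  rewrite mem_filter => /andP[/forallP sij _] ->; apply: Hh; last exact: wR.
  by have -> : sg i = sg j by apply/funext => u; apply/eqP.
pose F i := ([ffun v => sg i v], [ffun vk : V * coord =>
  inord (index (w i vk.1 vk.2) (L i vk.1 vk.2)) : 'I_C.+1]).
suff F_inj : injective F by have := leq_card _ F_inj; rewrite card_ord.
move=> i j [/ffunP sij /ffunP wij].
have {}sij : sg i = sg j by apply/funext => v; have := sij v; rewrite !ffunE.
have Lij : L i = L j by rewrite /L sij.
apply: w_inj => v; split=> [|k]; first by rewrite sij.
have := wij (v, k); rewrite !ffunE /= Lij => /(congr1 (@nat_of_ord _)).
have wiL : w i v k \in L j v k by rewrite -Lij.
rewrite !inordK ?(leq_trans _ (sL j v k)) ?index_mem // => /(congr1 (nth 0 (L j v k))).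
by rewrite !nth_index.
Qed.
End Copies.

(** * Restriction to finite subfields *)

Section FiniteSubfield.
Variables (K : closedFieldType) (p : nat).
Hypothesis charK : p \in [pchar K].

Lemma natr_inj_lt_pchar (n : nat) : (n <= p)%N -> injective (fun i : 'I_n => i%:R : K).
Proof.
move=> np i j; wlog ij : i j / (i <= j)%N => [H E|E].
  by case/orP: (leq_total i j) => ?; [apply: H | apply/esym/H].
apply/val_inj/eqP; rewrite /= eqn_leq ij -subn_eq0 /=.
case: (posnP (j - i)) => [//|ji].
have /(dvdn_leq ji) : (p %| j - i)%N by rewrite (dvdn_pcharf charK) natrB // E subrr.
rewrite leqNgt => /negP[]; apply: leq_trans np.
by apply: leq_ltn_trans (leq_subr _ _) _.
Qed.

Variable k : nat.
Hypothesis k_gt0 : (0 < k)%N.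
Let q := (p ^ k)%N.

(** The field with [q] elements, as the fixed points of the iterated Frobenius map. *)
Definition subfield_pred : {pred K} := [pred a | a ^+ q == a].

Lemma subfield_nat n : n%:R \in subfield_pred.
Proof.
rewrite inE /q.
elim: (k) => [|j IH]; first by rewrite expr1.
by rewrite expnSr exprM (eqP IH) -(pFrobenius_autE charK) pFrobenius_aut_nat.
Qed.

Lemma subfield_add : {in subfield_pred &, forall a1 a2, a1 + a2 \in subfield_pred}.
Proof.
move=> a1 a2; rewrite !inE => /eqP E1 /eqP E2; rewrite exprDn_pchar ?E1 ?E2 //.
by rewrite (eq_pnat _ (pcharf_eq charK)) pnatX pnat_id // (pcharf_prime charK).
Qed.

Lemma subfield_mul : {in subfield_pred &, forall a1 a2, a1 * a2 \in subfield_pred}.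
Proof. by move=> a1 a2; rewrite !inE exprMn => /eqP -> /eqP ->. Qed.

Lemma subfield_exp n : {in subfield_pred, forall a, a ^+ n \in subfield_pred}.
Proof. by move=> a; rewrite !inE -exprM mulnC exprM => /eqP ->. Qed.

(** The derivative of ['X^q - 'X] is -1, so this polynomial has [q] distinct roots. *)
Lemma subfield_elements :
  exists s : seq K, [/\ uniq s, size s = q & s =i subfield_pred].
Proof.
have p_pr := pcharf_prime charK.
have q1 : (1 < q)%N by rewrite -{1}(exp1n k) ltn_exp2r ?prime_gt1.
pose f : {poly K} := 'X^q - 'X.
have sf : size f = q.+1.
  by rewrite size_polyDl ?size_polyXn // size_polyN size_polyX.
have lf : lead_coef f = 1.
  by rewrite lead_coefDl ?lead_coefXn // size_polyN size_polyX size_polyXn.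
have [s def_f] := closed_field_poly_normal f; rewrite lf scale1r in def_f.
exists s; split.
- rewrite -separable_prod_XsubC -def_f unlock /f derivB derivXn derivX.
  rewrite -mulr_natr -polyC_natr natrX (pcharf0 charK) expr0n eqn0Ngt k_gt0 /=.
  by rewrite polyC0 mulr0 sub0r -(scaleN1r 1) coprimepZr ?coprimep1 ?oppr_eq0 ?oner_eq0.
- by have := size_prod_XsubC s id; rewrite -def_f sf => -[].
- move=> a; rewrite -root_prod_XsubC -def_f inE /root /f.
  by rewrite hornerD hornerN hornerXn hornerX subr_eq0.
Qed.

End FiniteSubfield.

(** * Connected graphs, tree powers and freeness *)

Section Trees.
Variables (V : finType) (T : sgraph V).

Lemma adj_irr (u v : V) : adj T u v -> u != v.
Proof.
move=> uv; have := forall_inP (edges_card2 T) _ uv.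
by rewrite cards2; case: (u != v).
Qed.

Lemma edge_ends (e : {set V}) : e \in edges T ->
  exists u v, adj T u v /\ e = [set u; v].
Proof.
move=> eT; have /cards2P[u [v [uv def_e]]] := forall_inP (edges_card2 T) e eT.
by exists u, v; split=> //; rewrite /adj -def_e.
Qed.

Lemma crossing_edge (S : {set V}) (a z : V) : connect (adj T) a z ->
  a \in S -> z \notin S -> exists u v, [/\ u \in S, v \notin S & adj T u v].
Proof.
case/connectP => s; elim: s a => [|v s IH] a /= => [_ -> -> //|].
move=> /andP[av vs] zE aS zS; case vS: (v \in S); first exact: IH vs zE vS zS.
by exists a, v; rewrite aS vS.
Qed.

Hypothesis T_conn : connected T.

Lemma connected_neighbour (u : V) : (1 < #|V|)%N -> exists v, adj T u v.
Proof.
move=> V1; have [z zu] : exists z, z != u.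
  have : (0 < #|predC1 u|)%N by rewrite cardC1 -subn1 subn_gt0.
  by move=> /card_gt0P[z]; exists z.
have [||v [w [vu wu vw]]] := @crossing_edge [set u] u z (T_conn.2 u z).
- by rewrite inE.
- by rewrite inE.
by exists w; rewrite inE in vu; rewrite -(eqP vu).
Qed.

(** A vertex set grows one vertex at a time along crossing edges, and each such edge is new inside
    the set. *)
Lemma connected_card : (#|V| <= #|edges T|.+1)%N.
Proof.
have [/card_gt0P[a _] H] := T_conn.
have grow n : (n < #|V|)%N -> exists S : {set V},
    [/\ a \in S, #|S| = n.+1 & (n <= #|[set e in edges T | e \subset S]|)%N].
  elim: n => [_|n IH nV]; first by exists [set a]; rewrite inE cards1.
  have [S [aS cS eS]] := IH (ltnW nV).
  have [z zS] : exists z, z \notin S.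
    apply/existsP; rewrite -negb_forall; apply: contraTN nV => /forallP H'.
    rewrite -leqNgt -cS; apply/subset_leq_card/subsetP => z _; exact: H'.
  have [u [v [uS vS uv]]] := crossing_edge (H a z) aS zS.
  exists (v |: S); split; first by rewrite inE aS orbT.
    by rewrite cardsU1 vS cS.
  rewrite (cardsD1 [set u; v]) inE [_ \in edges T]uv /= subUset !sub1set !inE eqxx uS orbT /=.
  rewrite ltnS; apply: leq_trans eS _; apply/subset_leq_card/subsetP => e.
  rewrite !inE => /andP[-> eS] /=; rewrite (subset_trans eS) ?subsetUr // andbT.
  by apply: contraNneq vS => eE; apply: (subsetP eS); rewrite eE !inE eqxx orbT.
have [V0|V0] := posnP #|V|; first by rewrite V0.
have [|S [_ _ H1]] := grow #|V|.-1; first by rewrite prednK.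
rewrite -(prednK V0) ltnS; apply: leq_trans H1 _.
by apply/subset_leq_card/subsetP => e; rewrite inE => /andP[].
Qed.

Lemma tree_power_free (roots : {set V}) (U : finType) (G : sgraph U) (p : nat) :
  (forall psi : 'I_p -> V -> U, (forall i, injective (psi i)) ->
    (forall i u v, adj T u v -> adj G (psi i u) (psi i v)) ->
    (forall i j, {in roots, psi i =1 psi j}) ->
    (forall i j, psi i =1 psi j -> i = j) -> False) ->
  family_free (tree_power T roots p) G.
Proof.
move=> H W F [phi [phi_inj phi_injs phiR _ phiE]] [f f_inj fE].
apply: (H (fun i v => f (phi i v))).
- by move=> i u v /f_inj/phi_injs.
- move=> i u v uv.
  suff : f @: (phi i @: [set u; v]) \in edges G.
    by rewrite !imsetU1 !imset_set1.
  apply: fE; rewrite -phiE; apply/bigcupP; exists i => //.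
  exact: imset_f.
- by move=> i j v vR; rewrite (phiR i j).
- by move=> i j ij; apply: phi_inj; apply/ffunP => v; apply/f_inj/ij.
Qed.

Lemma leq_extremal_number (F : graph_family) (n : nat) (G : sgraph 'I_n) :
  family_free F G -> (#|edges G| <= extremal_number n F)%N.
Proof.
by move=> GF; apply: (@leq_bigmax_cond _ _ (fun G : sgraph 'I_n => #|edges G|));
  apply/asboolP.
Qed.
End Trees.

(** * The finite graph over a subfield *)

Lemma alg_value_subfield (K : closedFieldType) (p k m d I J : nat)
    (c : slot m I J -> K) (l : 'I_m) (x y : coordinate m d -> K) :
    p \in [pchar K] ->
    (forall s, c s \in subfield_pred p k) ->
    (forall z, x z \in subfield_pred p k) ->
    (forall z, y (inr z) \in subfield_pred p k) ->
  alg_value c l x y \in subfield_pred p k.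
Proof.
move=> charK Hc Hx Hy.
have F0 : (0 : K) \in subfield_pred p k by apply: (subfield_nat charK k 0).
have FD := subfield_add charK (k := k).
apply: (big_ind (fun a => a \in subfield_pred p k)) => // i _.
apply: (big_ind (fun a => a \in subfield_pred p k)) => // j _.
apply: subfield_mul => //; apply: subfield_exp.
apply: (big_ind (fun a => a \in subfield_pred p k)) => // z _.
by apply: subfield_mul; [case: z | apply/subfield_exp/subfield_nat].
Qed.

Section FiniteGraph.
Variables (K : closedFieldType) (m d I J q n : nat) (s : seq K) (c : slot m I J -> K).
Hypotheses (s_uniq : uniq s) (size_s : size s = q).
Hypothesis s_closed : forall l (x y : coordinate m d -> K),
  (forall k, x k \in s) -> (forall k, y (inr k) \in s) -> alg_value c l x y \in s.
Hypothesis n_large : (2 * q ^ (m + d) <= n)%N.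

(** Points are stored by the positions of their coordinates in [s], which gives a finite type. *)
Definition grid := {ffun coordinate m d -> 'I_q}.
Definition grid_point (f : grid) (k : coordinate m d) : K := s`_(f k).

Lemma grid_point_inj (f g : grid) : grid_point f =1 grid_point g -> f = g.
Proof.
move=> E; apply/ffunP => k; apply/val_inj/eqP.
by have /eqP := E k; rewrite nth_uniq ?size_s.
Qed.

Lemma grid_coordinate a : a \in s -> exists r : 'I_q, s`_r = a.
Proof.
move=> a_s; have i_s : (index a s < q)%N by rewrite -size_s index_mem.
by exists (Ordinal i_s); rewrite nth_index.
Qed.

(** The left end and the last [d] coordinates of the right end are free; [s_closed] keeps the
    determined coordinates in [s]. Vertices of ['I_n] outside the image of [enc] are isolated. *)
Lemma exists_finite_graph : exists (G : sgraph 'I_n) (enc : bool * grid -> 'I_n),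
  [/\ injective enc, (q ^ (m + d) * q ^ d <= #|edges G|)%N &
    forall u v, adj G u v -> exists f g, [set u; v] = [set enc (false, f); enc (true, g)] /\
      alg_adj c (grid_point f) (grid_point g)].
Proof.
have cU : (#|{: bool * grid}| <= n)%N.
  by rewrite card_prod card_bool card_ffun card_sum !card_ord.
pose enc (u : bool * grid) : 'I_n := widen_ord cU (enum_rank u).
have enc_inj : injective enc.
  by move=> u v /(congr1 val) E; apply/enum_rank_inj/val_inj.
pose pair_edge (fg : grid * grid) := [set enc (false, fg.1); enc (true, fg.2)].
pose D := [set fg : grid * grid | `[< alg_adj c (grid_point fg.1) (grid_point fg.2) >]].
have E2 : [forall e in pair_edge @: D, #|e| == 2].
  by apply/forall_inP => _ /imsetP[[f g] _ ->]; rewrite cards2 (inj_eq enc_inj).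
exists (SGraph E2), enc; split=> //=; last first.
  move=> u v /imsetP[[f g]]; rewrite inE => /asboolP fg uv.
  by exists f, g.
rewrite card_imset => [|[f g] [f' g'] /setP E]; last first.
  have := E (enc (false, f)); have := E (enc (true, g)).
  rewrite !inE !(inj_eq enc_inj) !eqxx orbT /= => /esym/eqP[->].
  by rewrite orbF => /esym/eqP[->].
(* The value 0 on the first [m] coordinates is harmless, as [alg_value] does not read them. *)
pose point_of (w : grid * {ffun 'I_d -> 'I_q}) : coordinate m d -> K :=
  fun k => match k with inl _ => 0 | inr k => s`_(w.2 k) end.
have s_nth (r : 'I_q) : s`_r \in s by rewrite mem_nth ?size_s.
have /fin_all_exists[g0 Hg0] (w : grid * {ffun 'I_d -> 'I_q}) : exists g : grid,
   (forall k, g (inr k) = w.2 k) /\ alg_adj c (grid_point w.1) (grid_point g).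
  have /fin_all_exists[g Hg] (k : coordinate m d) : exists r : 'I_q, s`_r =
     match k with inl l => alg_value c l (grid_point w.1) (point_of w) | inr k => s`_(w.2 k) end.
    apply: grid_coordinate; case: k => [l|k] //.
    by apply: s_closed => k; apply: s_nth.
  exists [ffun k => g k]; split=> [k|l]; rewrite ?ffunE.
    by apply/val_inj/eqP; have /eqP := Hg (inr k); rewrite nth_uniq ?size_s.
  rewrite /grid_point ffunE Hg; apply: eq_bigr => i _; apply: eq_bigr => j _.
  congr (_ * _ ^+ _); apply: eq_bigr => -[k|k] _ //=.
  by rewrite ffunE Hg.
pose g1 w := (w.1, g0 w).
have g1_inj : injective g1.
  move=> [f z] [f' z'] [-> E]; congr (_, _); apply/ffunP => k.
  have [H _] := Hg0 (f', z); have [H' _] := Hg0 (f', z').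
  by rewrite -[LHS](H k) E; apply: H'.
rewrite (_ : _ * _ = #|{: grid * {ffun 'I_d -> 'I_q}}|)%N; last first.
  by rewrite card_prod !card_ffun card_sum !card_ord.
rewrite -(card_codom g1_inj); apply/subset_leq_card/subsetP => _ /codomP[w ->].
by rewrite inE; apply/asboolP; have [] := Hg0 w.
Qed.
End FiniteGraph.

Lemma algebraic_extremal_bound (K : closedFieldType) (V : finType) (T : sgraph V)
    (roots : {set V}) (d I J q n C : nat) (s : seq K)
    (c : slot #|~: roots| I J -> K) :
    connected T -> (1 < #|V|)%N -> uniq s -> size s = q ->
    (forall l (x y : coordinate #|~: roots| d -> K),
      (forall k, x k \in s) -> (forall k, y (inr k) \in s) -> alg_value c l x y \in s) ->
    (2 * q ^ (#|~: roots| + d) <= n)%N ->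
    (forall p (sg : 'I_p -> V -> bool) (w : 'I_p -> V -> coordinate #|~: roots| d -> K),
      (forall i, alg_copy T c (sg i) (w i)) ->
      (forall i j, {in roots, forall v, w i v =1 w j v}) ->
      (forall i j, (forall v, sg i v = sg j v /\ w i v =1 w j v) -> i = j) ->
      (p <= C)%N) ->
  (q ^ (#|~: roots| + d) * q ^ d <= extremal_number n (tree_power T roots C.+1))%N.
Proof.
move=> T_conn V1 s_uniq size_s s_closed n_large HC.
have [G [enc [enc_inj eG adjG]]] := exists_finite_graph s_uniq size_s s_closed n_large.
apply: leq_trans eG _; apply: leq_extremal_number.
apply: tree_power_free => psi psi_inj psi_adj psiR psi_eq.
have enc_cases i u v : adj T u v -> exists f g,
    alg_adj c (grid_point s f) (grid_point s g) /\
    ((psi i u = enc (false, f) /\ psi i v = enc (true, g)) \/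
     (psi i u = enc (true, g) /\ psi i v = enc (false, f))).
  move=> uv; have [f [g [/setP E fg]]] := adjG _ _ (psi_adj i u v uv).
  exists f, g; split=> //.
  have uv' : psi i u != psi i v by rewrite (inj_eq (psi_inj i)) (adj_irr uv).
  have := E (psi i u); have := E (psi i v); rewrite !inE !eqxx orbT /=.
  move=> /esym/orP[/eqP v1|/eqP v1] /esym/orP[/eqP u1|/eqP u1]; rewrite ?v1 ?u1; auto.
    by rewrite u1 v1 eqxx in uv'.
  by rewrite u1 v1 eqxx in uv'.
(* Every vertex of [T] has a neighbour, so its image is an end of an edge and hence encodes a grid
   point. *)
have /fin_all_exists[un Hun] i : exists un : V -> bool * grid #|~: roots| d q,
    forall u, psi i u = enc (un u).
  have /fin_all_exists[un Hun] u : exists z, psi i u = enc z; last by exists un.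
  have [v uv] := connected_neighbour T_conn u V1.
  by have [f [g [_ [] [-> _]]]] := enc_cases i u v uv; [exists (false, f) | exists (true, g)].
have := HC C.+1 (fun i v => (un i v).1) (fun i v => grid_point s (un i v).2).
rewrite ltnn => H; suff : false by []; apply: H.
- move=> i; split=> [u v sguv /(grid_point_inj s_uniq size_s) puv|u v uv].
    by apply: (psi_inj i); rewrite !Hun [un i u]surjective_pairing sguv puv -surjective_pairing.
  have [f [g [fg [] [/esym]]]] := enc_cases i u v uv; rewrite !Hun.
    by move=> /enc_inj <- /enc_inj ->.
  by move=> /enc_inj <- /enc_inj ->.
- by move=> i j v vR k; have := psiR i j v vR; rewrite !Hun => /enc_inj ->.
- move=> i j ij; apply: psi_eq => v; rewrite !Hun; congr enc.
  have [E1 /(grid_point_inj s_uniq size_s) E2] := ij v.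
  by rewrite [LHS]surjective_pairing [RHS]surjective_pairing E1 E2.
Qed.

(** * The extremal bound *)

Lemma exists_closed_field_pchar (p : nat) : prime p ->
  exists K : closedFieldType, p \in [pchar K].
Proof.
move=> p_pr; have [K [f _]] := countable_algebraic_closure 'F_p.
by exists K; rewrite (fmorph_pchar f) pchar_Fp.
Qed.

(** [p], [A], [C], [N] and [h] are all fixed before [k]. For [k] large the subfield has more
    elements than [h] has roots, while the bound [C] on copies stays the same. *)
Lemma algebraic_construction (V : finType) (T : sgraph V) (roots : {set V}) (d : nat) :
    connected T -> (1 < #|V|)%N ->
    (forall S : {set V}, S \subset ~: roots ->
      ((#|~: roots| + d) * #|S| <= #|~: roots| * #|[set e in edges T | e :&: S != set0]|)%N) ->
  exists p C k0 : nat, (1 < p)%N /\ forall k n, (k0 <= k)%N ->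
    (2 * (p ^ k) ^ (#|~: roots| + d) <= n)%N ->
    ((p ^ k) ^ (#|~: roots| + d) * (p ^ k) ^ d <= extremal_number n (tree_power T roots C.+1))%N.
Proof.
move=> T_conn V1 dense; set m := #|~: roots|.
pose J := (copies_needed roots d * #|V| ^ 2)%N.
(* [I] is chosen so that one of the [I] linear forms separates any [J] edges. *)
pose I := (J * J * #|free_coordinate m d|).+1.
have [p Ip p_pr] := prime_above I; have [K charK] := exists_closed_field_pchar p_pr.
have I_inj := natr_inj_lt_pchar charK (ltnW Ip).
have [A [C HC]] := copies_bounded K I J dense.
have [N /(_ N (leqnn N))[h h0 Hh]] := generically_sparse A I_inj (leqnn J) (ltnSn _).
exists p, C, (size h).+1; split=> [|k n hk nk]; first exact: prime_gt1.
have k0 : (0 < k)%N by apply: leq_trans hk.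
have [s [s_uniq size_s sE]] := subfield_elements charK k0.
have [t t_s ht] : exists2 t, t \in s & ~~ root h t.
  apply/hasP; rewrite has_predC; apply/negP => /(max_poly_roots h0)/(_ s_uniq).
  rewrite size_s ltnNge => /negP[]; apply: leq_trans (ltnW (ltn_expl k (prime_gt1 p_pr))).
  exact: ltnW.
apply: (algebraic_extremal_bound (c := moment_point (S := slot m I J) N t)
  T_conn V1 s_uniq size_s) => //.
  move=> l x y Hx Hy; rewrite sE; apply: alg_value_subfield => // [r|r|r].
  - by apply: subfield_exp; rewrite -sE.
  - by rewrite -sE.
  - by rewrite -sE.
exact/HC/Hh.
Qed.

Lemma balanced_dense (V : finType) (T : sgraph V) (roots : {set V}) :
    balanced T roots -> (0 < #|~: roots|)%N ->
  forall S : {set V}, S \subset ~: roots ->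
  (#|edges T| * #|S| <= #|~: roots| * #|[set e in edges T | e :&: S != set0]|)%N.
Proof.
move=> T_bal m0 S SR; have [->|S0] := eqVneq S set0; first by rewrite cards0 muln0.
have S1 : (0 < #|S|)%N by rewrite card_gt0.
have := T_bal S S0 SR; rewrite /density /set_density.
have -> : (#|V| - #|roots| = #|~: roots|)%N by rewrite [RHS]cardsCs setCK.
rewrite ler_pdivrMr ?ltr0n // mulrAC ler_pdivlMr ?ltr0n // -!natrM ler_nat.
by rewrite [(_ * #|~: _|)%N]mulnC.
Qed.

(* The graph joins [2 i] to [2 i + 1]: a tree with at least three vertices does not embed
   in it, and a tree with two vertices has at most four maps into a single edge. *)
Lemma matching_extremal (V : finType) (T : sgraph V) (roots : {set V}) (n : nat) :
    connected T -> (1 < #|V|)%N -> (2 <= n)%N ->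
  ((if #|V| == 2 then 1 else n./2) <= extremal_number n (tree_power T roots 5))%N.
Proof.
move=> T_conn V1 n2; set M := if _ then _ else _.
have Mn : (M <= n./2)%N by rewrite /M; case: ifP => // _; lia.
have iP (i : 'I_M) v : (v + i.*2 < n)%N || (1 < v)%N by have := ltn_ord i; lia.
have i0 (i : 'I_M) : (i.*2 < n)%N by have := ltn_ord i; lia.
have i1 (i : 'I_M) : (i.*2.+1 < n)%N by have := ltn_ord i; lia.
pose pair_edge i := [set Ordinal (i0 i); Ordinal (i1 i)].
have E2 : [forall e in pair_edge @: [set: 'I_M], #|e| == 2].
  by apply/forall_inP => _ /imsetP[i _ ->]; rewrite cards2 -val_eqE /= neq_ltn ltnSn.
pose G := SGraph E2.
have adjG (u v : 'I_n) : adj G u v -> (u./2 = v./2 /\ u./2 < M)%N.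
  move=> /imsetP[i _ /setP E].
  have := E u; have := E v; rewrite !inE !eqxx orbT /= => /esym/orP[]/eqP-> /esym/orP[]/eqP->;
    by have := ltn_ord i; rewrite /=; lia.
have -> : M = #|edges G|.
  rewrite card_imset ?cardsT ?card_ord // => i j /setP/(_ (Ordinal (i0 i))).
  rewrite !inE eqxx /= => /esym/orP[]/eqP/(congr1 val) /= ij; apply/val_inj => /=; lia.
apply: leq_extremal_number; apply: tree_power_free => psi psi_inj psi_adj _ psi_eq.
(* As [T] is connected, its image lies in a single edge of the matching. *)
have same i u v : ((psi i u)./2 = (psi i v)./2 /\ (psi i u)./2 < M)%N.
  split.
    have /connectP[s] := T_conn.2 u v.
    elim: s u => [|w s IH] u /= => [_ -> //|/andP[uw ws] vE].
    by rewrite (adjG _ _ (psi_adj i u w uw)).1; apply: IH.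
  have [w uw] := connected_neighbour T_conn u V1.
  by have [] := adjG _ _ (psi_adj i u w uw).
have V2 : #|V| = 2.
  apply/eqP; rewrite eqn_leq V1 andbT.
  have /card_gt0P[u0 _] := ltnW V1.
  pose f v := odd (psi ord0 v).
  suff f_inj : injective f by have := leq_card _ f_inj; rewrite card_bool.
  move=> u v; rewrite /f => uv; apply: (psi_inj ord0); apply/val_inj => /=.
  have [/= E _] := same ord0 u v.
  by rewrite -(odd_double_half (psi ord0 u)) uv E odd_double_half.
have M1 : M = 1 by rewrite /M V2.
pose F (i : 'I_5) := [ffun v => odd (psi i v)].
suff F_inj : injective F.
  by have := leq_card _ F_inj; rewrite card_ffun card_bool card_ord V2.
move=> i j /ffunP E; apply: psi_eq => v; apply/val_inj => /=.
have := E v; rewrite !ffunE.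
have [_] := same i v v; have [_] := same j v v.
rewrite M1; lia.
Qed.

(** For [q] the largest admissible power of [p], [n] is at most [2 * p ^ b * q ^ b]; the factor
    [2 * p ^ b] is absorbed by the constant, and [(q ^ b) ^ e = q ^ (b + d)]. *)
Lemma powR_bound_between_powers (R : realType) (f : nat -> nat) (b d p k0 : nat) (e : R) :
    (1 < p)%N -> (0 < b)%N -> 0 <= e -> e * b%:R = (b + d)%:R ->
    (forall k n, (k0 <= k)%N -> (2 * (p ^ k) ^ b <= n)%N ->
      ((p ^ k) ^ b * (p ^ k) ^ d <= f n)%N) ->
  exists (c : R) (n0 : nat), 0 < c /\
    forall n, (n0 <= n)%N -> c * n%:R `^ e <= (f n)%:R.
Proof.
move=> p1 b0 e0 eb Hf.
have P1 : (1 < p ^ b)%N by rewrite -{1}(exp1n b) ltn_exp2r.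
have c0 : 0 < (2 * p ^ b)%:R `^ e :> R.
  by rewrite powR_gt0 // ltr0n muln_gt0 expn_gt0 (ltnW p1).
exists ((2 * p ^ b)%:R `^ e)^-1, (2 * (p ^ b) ^ k0)%N.
split=> [|n n0]; first by rewrite invr_gt0.
have n20 : ((p ^ b) ^ k0 <= n %/ 2)%N by rewrite leq_divRL // mulnC.
have n2_gt0 : (0 < n %/ 2)%N by apply: leq_trans n20; rewrite !expn_gt0 (ltnW p1).
pose k := trunc_log (p ^ b) (n %/ 2).
have /andP[lo hi] := trunc_log_bounds P1 n2_gt0; rewrite -/k in lo hi.
have qE : ((p ^ k) ^ b = (p ^ b) ^ k)%N by rewrite -!expnM mulnC.
have nq : (n <= 2 * p ^ b * (p ^ k) ^ b)%N.
  rewrite qE -mulnA -expnS; apply: leq_trans (ltnW (ltn_ceil n (ltn0Sn 1))) _.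
  by rewrite mulnC leq_mul2l hi.
have {}Hf : ((p ^ k) ^ b * (p ^ k) ^ d <= f n)%N.
  apply: Hf; first exact: trunc_log_max.
  by rewrite qE mulnC -leq_divRL.
rewrite ler_pdivrMl //; apply: le_trans (_ : (2 * p ^ b * (p ^ k) ^ b)%:R `^ e <= _).
  by rewrite ge0_ler_powR ?nnegrE ?ler0n // ler_nat.
rewrite [in leLHS]natrM powRM ?ler0n // ler_wpM2l ?(ltW c0) //.
rewrite [X in X `^ e <= _]natrX -powR_mulrn ?ler0n // -powRrM [b%:R * e]mulrC eb.
by rewrite powR_mulrn ?ler0n // -natrX expnD ler_nat.
Qed.

Theorem lemma1p2 (R : realType) (V : finType) (T : sgraph V) (roots : {set V})
    (T_rooted : rooted_tree T roots) (T_balanced : balanced T roots)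
    (T_edge : (0 < #|edges T|)%N) :
  exists2 p : nat, (0 < p)%N &
    exists (c : R) (n0 : nat), 0 < c /\
      forall n : nat, (n0 <= n)%N ->
        c * n%:R `^ ratr (2 - 1 / density T roots)
          <= (extremal_number n (tree_power T roots p))%:R.
Proof.
have [[T_conn _] T_indep] := T_rooted.
have /card_gt0P[e /edge_ends[u [v [uv _]]]] := T_edge.
have V1 : (1 < #|V|)%N.
  by apply: leq_trans (max_card [set u; v]); rewrite cards2 (adj_irr uv).
set m := #|~: roots|; set b := #|edges T|.
(* Roots are independent, so an edge has an unrooted end. *)
have m0 : (0 < m)%N.
  rewrite card_gt0; apply: contraTneq uv => R0.
  by apply: T_indep; apply: contraT; rewrite -in_setC R0 inE.
have mV : (m <= #|V|)%N by apply: max_card.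
have Vb : (#|V| <= b.+1)%N by apply: connected_card.
have -> : ratr (2 - 1 / density T roots) = 2 - m%:R / b%:R :> R.
  rewrite /density (_ : #|V| - #|roots| = m)%N; last by rewrite /m [RHS]cardsCs setCK.
  by rewrite div1r invf_div rmorphB /= fmorph_div /= !ratr_nat.
have bR : b%:R != 0 :> R by rewrite pnatr_eq0 -lt0n.
have [mb|bm] := leqP m b.
  have bE : (m + (b - m) = b)%N by rewrite subnKC.
  have dense := balanced_dense T_balanced m0.
  have [|p [C [k0 [p1 H]]]] := @algebraic_construction V T roots (b - m) T_conn V1.
    by rewrite -/m bE.
  exists C.+1 => //; rewrite -/m bE in H.
  apply: (powR_bound_between_powers p1 T_edge _ _ H); first last.
    by rewrite mulrBl divfK // -natrM -natrB ?mul2n -?addnn ?(leq_trans mb) ?leq_addl // addnBA.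
  by rewrite subr_ge0 ler_pdivrMr ?ltr0n // -natrM ler_nat (leq_trans mb) // leq_pmull.
(* Here [m <= #|V| <= b.+1 <= m], so the exponent is [1 - 1/b]. For [b = 1] it is 0 and one edge
   suffices; otherwise it is at most 1 and [n <= 4 * n./2] gives the constant 1/4. *)
exists 5 => //; exists (4%:R)^-1, 2; split=> [|n n2]; first by rewrite invr_gt0 ltr0n.
have := matching_extremal roots T_conn V1 n2.
have -> : #|V| = b.+1 by apply/eqP; rewrite eqn_leq Vb (leq_trans bm).
have -> : m = b.+1 by apply/eqP; rewrite eqn_leq bm (leq_trans mV).
rewrite eqSS -(natr1 b) mulrDl divff // => H.
have -> : 2 - (1 + 1 / b%:R) = 1 - b%:R^-1 :> R by rewrite div1r opprD addrA addrK.
rewrite ler_pdivrMl ?ltr0n // -natrM.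
case: eqP H => [->|b1] H.
  rewrite invr1 subrr powRr0 (_ : 1 = 1%:R) // ler_nat.
  by rewrite (leq_trans H) // leq_pmull.
apply: le_trans (_ : n%:R `^ 1 <= _).
  by rewrite ler_powR ?ler1n ?(ltnW n2) // lerBlDr lerDl invr_ge0 ler0n.
rewrite powRr1 ?ler0n // ler_nat; apply: leq_trans (_ : 4 * n./2 <= _)%N; first by lia.
by rewrite leq_mul2l H.
Qed.
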